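(* Let $n\ge1$, let $q_k$ ($k=1,\dots,n$) be real valued locally integrable functions on $[t_0;+\infty)$, let $\alpha_k$ ($k=1,\dots,n$) be real valued measurable locally bounded functions on $[t_0;+\infty)$, and let $p$ be a positive function on $[t_0;+\infty)$ with $1/p$ locally integrable on $[t_0;+\infty)$. Suppose that $q_k(t)\ge0$ for $t\ge t_0$ and $\lim_{t\to+\infty}\alpha_k(t)=+\infty$, $k=1,\dots,n$, and that $\int_{t_0}^{+\infty}\frac{d\tau}{p(\tau)}=+\infty$. Let $\Omega_+$ be the set of those $k\in\{1,\dots,n\}$ for which there is $t_k\ge t_0$ with $\alpha_k(t)\ge t$ for all $t\ge t_k$, and let $\Omega_-$ be the set of those $k\in\{1,\dots,n\}$ for which there is $t_k\ge t_0$ with $\alpha_k(t)\le t$ for all $t\ge t_k$. Suppose $\Omega_-\cup\Omega_+\neq\emptyset$ and $$\int_{t_0}^{+\infty}\Bigl[\sum_{k\in\Omega_+}q_k(\tau)\Bigr]d\tau<+\infty.$$ Suppose that for each $t_1\ge t_0$ the ordinary differential equation $$(p(t)\phi'(t))'+\Biggl[\sum_{k\in\Omega_+}q_k(t)\exp\Bigl\{\int_t^{\alpha_k(t)}\frac{1}{p(\tau)}\Bigl(\int_\tau^{+\infty}\sum_{j\in\Omega_+}q_j(s)\,ds\Bigr)d\tau\Bigr\}+\sum_{k\in\Omega_-\setminus\Omega_+}q_k(t)\frac{\int_{t_1}^{\alpha_k(t)}\frac{d\tau}{p(\tau)}}{\int_{t_1}^{t}\frac{d\tau}{p(\tau)}}\Biggr]\phi(t)=0,\quad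 t>t_1,$$ is oscillatory. Then the equation $$(p(t)\phi'(t))'+\sum_{k=1}^n q_k(t)\phi(\alpha_k(t))=0,\qquad t\ge t_0,$$ is oscillatory.
   Context: Let $T_0=\min\{t_0,\ \inf_{t\ge t_0,\,1\le k\le n}\alpha_k(t)\}$. A solution of $(p\phi')'+\sum_k q_k(t)\phi(\alpha_k(t))=0$, $t\ge t_0$, is a real valued continuous function $\phi$ on $[T_0;+\infty)$ that is locally absolutely continuous on $[t_0;+\infty)$, such that $p\phi'$ is (after modification on a null set) locally absolutely continuous on $[t_0;+\infty)$, and such that the equation holds almost everywhere on $[t_0;+\infty)$; this equation is called oscillatory if each of its solutions has arbitrarily large zeros. For an ordinary differential equation $(p\phi')'+Q(t)\phi=0$ with $Q$ defined for all sufficiently large $t$, a solution is a function $\phi$ on some half-line $[T;+\infty)$ on which $Q$ is defined (here $T>t_1$), with $\phi$ and $p\phi'$ locally absolutely continuous, satisfying the equation almost everywhere on $[T;+\infty)$; the equation is oscillatory if each of its solutions has arbitrarily large zeros. The integral $\int_\xi^\eta$ is taken in the direction from $\xi$ to $\eta$, i.e. $\int_\xi^\eta=-\int_\eta^\xi$ if $\eta<\xi$. Empty sums are zero. *)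

(* Defs.v *)
From HB Require Import structures.
From mathcomp Require Import all_boot all_order all_algebra.
From mathcomp Require Import all_classical all_reals all_analysis.

Set Implicit Arguments.
Unset Strict Implicit.
Unset Printing Implicit Defensive.

Import Order.TTheory GRing.Theory Num.Theory.
Import numFieldNormedType.Exports.

Local Open Scope classical_set_scope.
Local Open Scope ring_scope.

(* Measurability, integrability and "almost everywhere" are those of Lebesgue,
   not of Borel: [lebR R] is R with the Lebesgue (Caratheodory) sigma-algebra,
   on which the completed Lebesgue measure lives. *)
Notation lebR R := (caratheodory_type (@wlength R idfun)^*%mu).
Notation leb := completed_lebesgue_measure.

Definition locally_integrable_from (R : realType) (a : R) (f : R -> R) : Prop :=
  forall b : R, leb.-integrable (`[a, b] : set (lebR R)) (EFin \o f).

Definition lebesgue_measurable_from (R : realType) (a : R) (f : R -> R) : Prop :=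
  measurable_fun (`[a, +oo[ : set (lebR R)) (f : lebR R -> R).

Definition locally_bounded_from (R : realType) (a : R) (f : R -> R) : Prop :=
  forall b : R, [bounded f t | t in `[a, b]].

(* Lebesgue integral of [f] taken in the direction from [a] to [b]. *)
Definition integral_from_to (R : realType) (a b : R) (f : R -> R) : R :=
  if a <= b then \int[leb]_(x in (`[a, b] : set (lebR R))) f x
  else - \int[leb]_(x in (`[b, a] : set (lebR R))) f x.

Definition absolutely_continuous_on (R : realType) (a b : R) (f : R -> R) : Prop :=
  forall e : R, 0 < e -> exists2 d : R, 0 < d &
    forall (m : nat) (x y : 'I_m -> R),
      (forall i, a <= x i /\ x i <= y i /\ y i <= b) ->
      trivIset setT (fun i : 'I_m => `]x i, y i[%classic) ->
      \sum_(i < m) (y i - x i) < d ->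
      \sum_(i < m) `|f (y i) - f (x i)| < e.

Definition locally_absolutely_continuous_from (R : realType) (a : R)
    (f : R -> R) : Prop :=
  forall b : R, absolutely_continuous_on a b f.

(* [(p phi')' + F = 0] almost everywhere on [[a, +oo[], where [psi] is the
   locally absolutely continuous modification of [p phi']. *)
Definition second_order_equation_from (R : realType) (a : R) (p phi F : R -> R)
    : Prop :=
  exists psi : R -> R,
    [/\ locally_absolutely_continuous_from a psi,
        {ae leb, forall t : lebR R, a <= (t : R) ->
           derivable phi (t : R) 1 /\ psi t = p t * derive1 phi (t : R)} &
        {ae leb, forall t : lebR R, a <= (t : R) ->
           derivable psi (t : R) 1 /\ derive1 psi (t : R) + F t = 0}].

Definition arbitrarily_large_zeros (R : realType) (phi : R -> R) : Prop :=
  forall M : R, exists2 t : R, M <= t & phi t = 0.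

Definition initial_point (R : realType) (n : nat) (t0 : R)
    (alpha : 'I_n -> R -> R) : R :=
  Num.min t0 (inf [set s | exists k : 'I_n, exists2 t : R, t0 <= t & s = alpha k t]).

Definition delay_solution (R : realType) (n : nat) (t0 : R) (p : R -> R)
    (q alpha : 'I_n -> R -> R) (phi : R -> R) : Prop :=
  [/\ {within `[initial_point t0 alpha, +oo[, continuous phi},
      locally_absolutely_continuous_from t0 phi &
      second_order_equation_from t0 p phi
        (fun t => \sum_(k < n) q k t * phi (alpha k t))].

Definition delay_oscillatory (R : realType) (n : nat) (t0 : R) (p : R -> R)
    (q alpha : 'I_n -> R -> R) : Prop :=
  forall phi : R -> R,
    delay_solution t0 p q alpha phi -> arbitrarily_large_zeros phi.

(* [D] is the set on which the coefficient [Q] is defined; the values of [Q]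
   outside [D] are irrelevant. *)
Definition ode_solution (R : realType) (D : set R) (p Q : R -> R) (T : R)
    (phi : R -> R) : Prop :=
  [/\ `[T, +oo[ `<=` D,
      locally_absolutely_continuous_from T phi &
      second_order_equation_from T p phi (fun t => Q t * phi t)].

Definition ode_oscillatory (R : realType) (D : set R) (p Q : R -> R) : Prop :=
  forall (T : R) (phi : R -> R),
    ode_solution D p Q T phi -> arbitrarily_large_zeros phi.

Definition Omega_plus (R : realType) (n : nat) (t0 : R)
    (alpha : 'I_n -> R -> R) : {set 'I_n} :=
  [set k : 'I_n | `[< exists2 tk : R, t0 <= tk &
                        forall t : R, tk <= t -> t <= alpha k t >]]%SET.

Definition Omega_minus (R : realType) (n : nat) (t0 : R)
    (alpha : 'I_n -> R -> R) : {set 'I_n} :=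
  [set k : 'I_n | `[< exists2 tk : R, t0 <= tk &
                        forall t : R, tk <= t -> alpha k t <= t >]]%SET.

Definition comparison_coefficient (R : realType) (n : nat) (t0 : R) (p : R -> R)
    (q alpha : 'I_n -> R -> R) (t1 t : R) : R :=
  let Op := Omega_plus t0 alpha in
  let Om := Omega_minus t0 alpha in
  \sum_(k in Op)
     q k t * expR (integral_from_to t (alpha k t)
       (fun tau => (p tau)^-1 *
          \int[leb]_(s in (`[tau, +oo[ : set (lebR R))) \sum_(j in Op) q j s))
  + \sum_(k in (Om :\: Op)%SET)
     q k t * (integral_from_to t1 (alpha k t) (fun tau => (p tau)^-1)
              / integral_from_to t1 t (fun tau => (p tau)^-1)).

(* As [p] and the [q k] are given on [[t0, +oo[] only, the coefficient makes
   sense only where the deviated arguments occurring in it are at least [t0]. *)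
Definition comparison_domain (R : realType) (n : nat) (t0 : R)
    (alpha : 'I_n -> R -> R) (t1 : R) : set R :=
  [set t | t1 < t /\ forall k : 'I_n,
     k \in (Omega_plus t0 alpha :|: Omega_minus t0 alpha)%SET ->
     t0 <= alpha k t].

(* Main.v *)
Require Import Defs.
From HB Require Import structures.
From mathcomp Require Import all_boot all_order all_algebra.
From mathcomp Require Import all_classical all_reals all_analysis.
From mathcomp Require Import measurable_realfun ring lra.

Import Order.TTheory GRing.Theory Num.Theory.
Import numFieldNormedType.Exports.

Local Open Scope classical_set_scope.
Local Open Scope ring_scope.

(** Why the theorem is true.  A delay solution without arbitrarily large zeros
may be taken positive on a half-line, after a change of sign.  There the
quasi-derivative [psi = p phi'] is nonincreasing, because all the terms
[q_k phi(alpha_k)] are nonnegative; it is nonnegative, because a negative value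
would force [phi] to [-oo] as [1/p] has infinite integral; hence [phi] is
nondecreasing ([quasiderivative_nonincreasing], [quasiderivative_ge0],
[positive_solution_nondecreasing]).

This gives lower bounds of [phi (alpha_k t)] by [phi t].  For a retarded
argument, [phi] is concave as a function of [P = int 1/p], so [phi / P] is
nonincreasing ([positive_solution_ratio]).  For an advanced argument, integrating
the equation gives [psi / phi >= G], where [G t] is the integral of the [q_j], [j] in
[Omega_plus], over [[t, +oo[] ([quasiderivative_ge_tail]); since
[(ln phi)' = psi / (p phi)], this makes [phi] grow at least like [exp (int G / p)]
([positive_solution_growth]).  The two bounds together say that
[Q phi <= sum_k q_k phi(alpha_k)], where [Q] is the comparison coefficient, so that
[r = psi / phi] is a supersolution of the Riccati equation
[u(t) = int_t^oo (Q + u^2 / p)] ([riccati_inequality]).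

The integral operator on the right is monotone in [u >= 0], and it produces
nonincreasing functions.  By the argument of Knaster and Tarski it has a fixed
point [0 <= u <= r] ([riccati_fixed_point]), and [exp (int u / p)] is then a positive
solution of [(p y')' + Q y = 0] ([riccati_positive_solution]).  This contradicts the
oscillation of the comparison equation.  Going through the Riccati equation
avoids an existence theorem for linear equations with merely integrable
coefficients.

All the passages between derivatives and integrals rest on one fact: a function
that is absolutely continuous on [[a, b]] and has almost everywhere a
derivative [<= 0] is nonincreasing ([ac_ae_nonincreasing]).  Combined with the Lebesgue
differentiation theorem it yields integral inequalities from differential ones
([ac_le_integral], [ac_ge_integral]). *)

(** * Lebesgue and Borel measurability, Lebesgue differentiation *)

Section LebesgueBridge.
Context {R : realType}.
Notation mu := (@lebesgue_measure R).

Lemma borel_lebesgue_measurable (A : set (measurableTypeR R)) :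
  measurable A -> measurable (A : set (lebR R)).
Proof. by move=> mA; exact: sub_caratheodory. Qed.

Lemma lebesgue_measurable_itv (i : interval R) :
  measurable ([set` i] : set (lebR R)).
Proof. by apply: borel_lebesgue_measurable; exact: measurable_itv. Qed.

Lemma borel_lebesgue_measurable_fun (D : set R) (f : R -> R) :
  measurable_fun (D : set (measurableTypeR R)) (f : measurableTypeR R -> R) ->
  measurable (D : set (measurableTypeR R)) ->
  measurable_fun (D : set (lebR R)) (f : lebR R -> R).
Proof.
move=> mf mD _ Y mY; apply: borel_lebesgue_measurable.
exact: mf.
Qed.

Lemma lebesgue_negligible_borel (N : set R) :
  leb.-negligible (N : set (lebR R)) <-> mu.-negligible N.
Proof.
split.
  case=> A [mA A0 NA]; apply/negligible_outer_measure.
  apply/eqP; rewrite eq_le outer_measure_ge0 andbT -A0.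
  exact: le_outer_measure.
case=> A [mA A0 NA]; exists A; split => //.
exact: borel_lebesgue_measurable.
Qed.

Lemma lebesgue_ae_borel (P : R -> Prop) :
  {ae leb, forall t : lebR R, P t} <-> {ae mu, forall t, P t}.
Proof. exact: lebesgue_negligible_borel. Qed.

(** Null sets of the completed measure are null for the outer measure, which
open sets compute. *)
Lemma negligible_open_cover (N : set R) (d : R) :
  leb.-negligible (N : set (lebR R)) -> 0 < d ->
  exists U : set R, [/\ open U, N `<=` U & (mu U < d%:E)%E].
Proof.
move=> /lebesgue_negligible_borel /negligible_outer_measure N0 d0.
have [U [oU NU mU]] := outer_measure_open_le N (divr_gt0 d0 (ltr0Sn R 1)).
exists U; split => //; rewrite (le_lt_trans mU)// N0 add0e lte_fin.
by rewrite ltr_pdivrMr// ltr_pMr// ltr1n.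
Qed.

(** The Caratheodory sigma-algebra is the completion of the Borel one. *)
Lemma lebesgue_measurable_decomp (A : set R) :
  measurable (A : set (lebR R)) ->
  exists B : set (measurableTypeR R), exists N : set (measurableTypeR R),
    [/\ measurable B, measurable N, mu N = 0%E, B `<=` A & A `<=` B `|` N].
Proof.
rewrite -[X in X -> _]/((wlength idfun)^*%mu.-cara.-measurable A).
rewrite -completed_caratheodory_measurable g_sigma_completed_algebra_genE.
case=> B mB [N [N' [mN' N'0 NN']]] <-; exists B, N'; split => //.
by move=> x [|/NN']; [left|right].
Qed.

(** Each rational superlevel set of [f] is Borel up to a Borel null set; replacing
[f] by [0] on the union [M] of these countably many null sets makes every
superlevel set Borel. *)
Lemma lebesgue_borel_ae (f : R -> R) :
  measurable_fun (setT : set (lebR R)) (f : lebR R -> R) ->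
  exists2 g : R -> R, measurable_fun (setT : set (measurableTypeR R)) g &
   {ae leb, forall t : lebR R, f t = g t}.
Proof.
move=> mf.
have decomp (r : rat) : exists BN : set (measurableTypeR R) * set (measurableTypeR R),
    [/\ measurable BN.1, measurable BN.2, mu BN.2 = 0%E,
        BN.1 `<=` [set x | ratr r < f x] &
        [set x | ratr r < f x] `<=` BN.1 `|` BN.2].
  have : measurable ([set x | ratr r < f x] : set (lebR R)).
    rewrite -[X in measurable X]setTI.
    have -> : [set x | ratr r < f x] = f @^-1` `]ratr r, +oo[%classic.
      by apply/seteqP; split=> x /=; rewrite in_itv/= andbT.
    by apply: mf => //; exact: measurable_itv.
  by case/lebesgue_measurable_decomp => B [N H]; exists (B, N).
have [BN HBN] := choice decomp.
pose M : set (measurableTypeR R) := \bigcup_r (BN r).2.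
have mM : measurable M.
  by apply: bigcupT_measurable_rat => r; case: (HBN r).
have M0 : mu.-negligible M.
  (* rationals are enumerated by [pickle] *)
  pose F (n : nat) : set (measurableTypeR R) :=
    if unpickle n is Some r then (BN r).2 else set0.
  have -> : M = \bigcup_n F n.
    apply/seteqP; split=> x [r _ Hr].
      by exists (pickle r); [exact: I|rewrite /F pickleK].
    by move: Hr; rewrite /F; case: unpickle => // r' ?; exists r'.
  apply: negligible_bigcup => n; rewrite /F; case: unpickle => [r|].
    by case: (HBN r) => _ m2 z _ _; exists (BN r).2; split.
  exact: negligible_set0.
exists (fun x => if x \in M then 0 else f x); last first.
  apply/lebesgue_ae_borel; apply: negligibleS M0 => x /=.
  by case: ifPn => // xM _; rewrite inE in xM.
apply: (measurability _ (RGenOInfty.measurableE R)) => //.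
move=> /= _ [_ [x ->] <-]; rewrite setTI.
pose F r : set (measurableTypeR R) :=
  if x <= ratr r then (BN r).1 `\` M else set0.
suff -> : (fun x0 => if x0 \in M then 0 else f x0) @^-1` `]x, +oo[%classic =
    (\bigcup_r F r) `|` (if x < 0 then M else set0).
  apply: measurableU; last by case: ifP.
  apply: bigcupT_measurable_rat => r; rewrite /F; case: ifP => // _.
  by apply: measurableD => //; case: (HBN r).
apply/seteqP; split=> y /=; rewrite in_itv/= andbT.
  case: ifPn => yM; first by move=> ->; right; rewrite inE in yM.
  move=> /rat_in_itvoo[r]; rewrite in_itv/= => /andP[xr ry].
  left; exists r => //; rewrite /F (ltW xr).
  have nM : ~ M y by move/mem_set => yM'; rewrite yM' in yM.
  split => //.
  case: (HBN r) => _ _ _ _ /(_ _ ry)[//|yN].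
  by exfalso; apply: nM; exists r.
case=> [[r _]|]; last by case: ifP => // x0 yM; rewrite mem_set.
rewrite /F; case: ifP => // xr -[yB yM]; rewrite memNset//.
by case: (HBN r) => _ _ _ /(_ _ yB) /= + _; exact: le_lt_trans.
Qed.

(** Lebesgue measure on Borel sets is the image of the completed measure under the
identity, which is measurable from the larger sigma-algebra to the smaller. *)
Lemma lebesgue_integral_borel (D : set R) (g : R -> \bar R) :
  measurable (D : set (measurableTypeR R)) ->
  measurable_fun (setT : set (measurableTypeR R)) (g : measurableTypeR R -> \bar R) ->
  leb.-integrable (D : set (lebR R)) g ->
  mu.-integrable D g /\
  (\int[leb]_(x in (D : set (lebR R))) g x = \int[mu]_(x in D) g x)%E.
Proof.
move=> mD mg ig.
pose phi : lebR R -> measurableTypeR R := idfun.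
have mphi : measurable_fun setT phi.
  by move=> _ Y mY; rewrite setTI; exact: borel_lebesgue_measurable.
have eqm (h : measurableTypeR R -> \bar R) :
    (\int[pushforward leb phi]_(x in D) h x = \int[mu]_(x in D) h x)%E.
  exact: eq_measure_integral.
split; last first.
  by rewrite -eqm integral_pushforward.
have /integrableP[mg' ig'] : (pushforward leb phi).-integrable D g.
  exact: integrable_pushforward.
by apply/integrableP; split => //; rewrite -eqm.
Qed.

(** Transfers to the completed measure what is known of integrals with respect to
the Borel measure: one [g] serves for all Borel subsets of [E]. *)
Lemma lebesgue_integrable_borel (E : set R) (f : R -> R) :
  measurable (E : set (measurableTypeR R)) ->
  leb.-integrable (E : set (lebR R)) (EFin \o f) ->
  exists g : R -> R, [/\ mu.-integrable E (EFin \o g),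
    {ae leb, forall t : lebR R, E t -> f t = g t} &
    forall D : set (measurableTypeR R), measurable D -> D `<=` E ->
      \int[leb]_(t in (D : set (lebR R))) f t = \int[mu]_(t in D) g t].
Proof.
move=> mE intf.
have mab := borel_lebesgue_measurable _ mE.
have mf : measurable_fun (setT : set (lebR R)) (f \_ E : lebR R -> R).
  apply: (measurable_restrictT (f : lebR R -> R) mab).1.
  by apply/measurable_EFinP; exact: measurable_int intf.
have [g mg fg] := lebesgue_borel_ae _ mf.
have mgl (D : set (lebR R)) : measurable_fun D (g : lebR R -> R).
  apply: measurable_funTS; exact: borel_lebesgue_measurable_fun.
have fg' : {ae leb, forall t : lebR R, E t -> f t = g t}.
  by apply: filterS fg => t + tE; rewrite patchE mem_set.
have intS (D : set (measurableTypeR R)) : measurable D -> D `<=` E ->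
    leb.-integrable (D : set (lebR R)) (EFin \o f).
  by move=> mD Dab; apply: integrableS intf => //; exact: borel_lebesgue_measurable.
have aeq (D : set (measurableTypeR R)) : D `<=` E ->
    ae_eq leb (D : set (lebR R)) (EFin \o f) (EFin \o g).
  by move=> Dab; apply: filterS fg' => t H /Dab tE /=; rewrite H.
have ig (D : set (measurableTypeR R)) : measurable D -> D `<=` E ->
    leb.-integrable (D : set (lebR R)) (EFin \o g).
  move=> mD Dab; apply/integrableP; split.
    by apply/measurable_EFinP; exact: mgl.
  have /integrableP[_] := intS _ mD Dab; congr (_ < _)%E.
  have mD' := borel_lebesgue_measurable _ mD.
  apply: ae_eq_integral.
  - exact: mD'.
  - by apply: measurableT_comp => //; exact: measurable_int (intS _ mD Dab).
  - by apply: measurableT_comp => //; apply/measurable_EFinP; exact: mgl.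
  - by apply: filterS (aeq _ Dab) => t H /H /= [->].
exists g; split => //.
  apply: (lebesgue_integral_borel _ _ _ _ (ig _ _ (@subset_refl _ _))).1 => //.
  exact/measurable_EFinP.
move=> D mD Dab; rewrite /Rintegral; congr fine.
rewrite -(lebesgue_integral_borel _ _ _ _ (ig _ mD Dab)).2//; last first.
  exact/measurable_EFinP.
apply: ae_eq_integral.
- exact: borel_lebesgue_measurable.
- exact: measurable_int (intS _ mD Dab).
- by apply/measurable_EFinP; exact: mgl.
- exact: aeq.
Qed.

(** Almost every point is a Lebesgue point of the Borel version of [f]. *)
Lemma lebesgue_FTC1 (a b : R) (f : R -> R) :
  leb.-integrable (`[a, b] : set (lebR R)) (EFin \o f) ->
  let F x := \int[leb]_(t in (`[a, x] : set (lebR R))) f t in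
  {ae leb, forall x : lebR R, a < (x : R) -> (x : R) < b ->
     derivable F (x : R) 1 /\ derive1 F (x : R) = f x}.
Proof.
move=> intf F.
have [g [ig fg Fg]] := lebesgue_integrable_borel _ _ (measurable_itv `[a, b]) intf.
have /lebesgue_differentiation/lebesgue_ae_borel dg :
    locally_integrable [set: R] (g \_ `[a, b]).
  exact: integrable_locally.
apply: (@filterS2 _ _ (ae_filter_ringOfSetsType leb)) dg fg => x dg fg ax xb.
pose gr := g \_ `[a, b].
have igr : mu.-integrable [set` Interval (BLeft a) (BRight b)] (EFin \o gr).
  apply: eq_integrable ig => // t; rewrite inE => tab /=.
  by rewrite /gr patchE mem_set.
have ax' : (BLeft a < BRight (x : R))%E by rewrite /= lte_fin.
have [] := FTC1_lebesgue_pt xb igr ax' dg.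
set G := (fun y => _) => dG DG.
have GF : \forall y \near x, G y = F y.
  have : \forall y \near x, y < b by exact: lt_nbhsl.
  apply: filterS => y yb; rewrite /G /F Fg//; last first.
    by apply: subset_itvl; rewrite bnd_simp ltW.
  apply: eq_Rintegral => t; rewrite inE /= in_itv/= => /andP[aT ty].
  by rewrite /gr patchE mem_set//= in_itv/= aT (le_trans ty)// ltW.
split; first exact: near_eq_derivable GF dG.
rewrite derive1E -(near_eq_derive _ GF) -derive1E DG /gr patchE mem_set.
  by rewrite fg//= in_itv/= !ltW.
by rewrite /= in_itv/= !ltW.
Qed.
End LebesgueBridge.

(** * Absolutely continuous functions *)

Section AbsoluteContinuity.
Context {R : realType}.
Implicit Types (a b : R) (f g h : R -> R).
Notation mu := (@lebesgue_measure R).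

(** Differences, products of bounded functions and compositions with Lipschitz
functions are absolutely continuous for the same reason: their increments are at
most a multiple of those of the given functions. *)
Lemma ac_dominated a b (C : R) f g h : 0 < C ->
  absolutely_continuous_on a b f -> absolutely_continuous_on a b g ->
  (forall x y, a <= x -> x <= y -> y <= b ->
     `|h y - h x| <= C * (`|f y - f x| + `|g y - g x|)) ->
  absolutely_continuous_on a b h.
Proof.
move=> C0 acf acg Hh e e0.
have e1 : 0 < e / C / 2 by rewrite !divr_gt0.
have [d1 d10 H1] := acf _ e1; have [d2 d20 H2] := acg _ e1.
exists (Num.min d1 d2); first by rewrite lt_min d10 d20.
move=> m x y xy tr; rewrite lt_min => /andP[s1 s2].
have := ltrD (H1 m x y xy tr s1) (H2 m x y xy tr s2).
rewrite -splitr -big_split/= ltr_pdivlMr// mulrC mulr_sumr.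
apply: le_lt_trans; apply: ler_sum => i _.
by have [? [? ?]] := xy i; exact: Hh.
Qed.

Lemma ac_lipschitz a b (C : R) f h : 0 < C ->
  absolutely_continuous_on a b f ->
  (forall x y, a <= x -> x <= y -> y <= b ->
     `|h y - h x| <= C * `|f y - f x|) ->
  absolutely_continuous_on a b h.
Proof.
move=> C0 acf Hh; apply: (ac_dominated a b C f f h) => // x y ax xy yb.
rewrite (le_trans (Hh x y ax xy yb))// ler_wpM2l ?(ltW C0)//.
by rewrite lerDl.
Qed.

Lemma acN a b f : absolutely_continuous_on a b f ->
  absolutely_continuous_on a b (fun x => - f x).
Proof.
move=> acf; apply: (ac_lipschitz a b 1 f) => // x y _ _ _.
by rewrite mul1r -opprD normrN.
Qed.

Lemma acB a b f g : absolutely_continuous_on a b f ->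
  absolutely_continuous_on a b g ->
  absolutely_continuous_on a b (fun x => f x - g x).
Proof.
move=> acf acg; apply: (ac_dominated a b 1 f g) => // x y _ _ _.
rewrite mul1r; have -> : f y - g y - (f x - g x) = (f y - f x) - (g y - g x).
  by rewrite !opprB addrACA [RHS]addrACA; congr (_ + _); rewrite addrC.
exact: ler_normB.
Qed.

Lemma ac_bounded_mul a b (A B : R) f g :
  (forall x, a <= x -> x <= b -> `|f x| <= A) ->
  (forall x, a <= x -> x <= b -> `|g x| <= B) ->
  absolutely_continuous_on a b f -> absolutely_continuous_on a b g ->
  absolutely_continuous_on a b (fun x => f x * g x).
Proof.
move=> fA gB acf acg.
have C0 : 0 < 1 + `|A| + `|B| by rewrite -addrA ltr_pwDl// addr_ge0.
apply: (ac_dominated a b _ f g _ C0) => // x y ax xy yb.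
have -> : f y * g y - f x * g x = (f y - f x) * g y + f x * (g y - g x).
  by rewrite mulrBl mulrBr addrA subrK.
rewrite (le_trans (ler_normD _ _))// !normrM mulrDr lerD//.
  rewrite mulrC ler_wpM2r// (le_trans (gB y _ _))// ?(le_trans ax)//.
  by rewrite (le_trans (ler_norm _))// lerDr addr_ge0.
rewrite ler_wpM2r// (le_trans (fA x _ _))// ?(le_trans xy)//.
by rewrite (le_trans (ler_norm _))// -addrA addrCA lerDl addr_ge0.
Qed.

Lemma ac_subitv a b (c d : R) f : a <= c -> d <= b ->
  absolutely_continuous_on a b f -> absolutely_continuous_on c d f.
Proof.
move=> ac db acf e /acf[r r0 H]; exists r => // m x y xy; apply: H => i.
by have [cx [? yd]] := xy i; rewrite (le_trans ac)// (le_trans yd).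
Qed.

(** The inverse is Lipschitz on [[c, +oo[] with constant [c^-2]. *)
Lemma ac_inv a b (c : R) f : 0 < c ->
  (forall x, a <= x -> x <= b -> c <= f x) ->
  absolutely_continuous_on a b f ->
  absolutely_continuous_on a b (fun x => (f x)^-1).
Proof.
move=> c0 cf acf; apply: (ac_lipschitz a b (c^-1 * c^-1) f) => //.
  by rewrite mulr_gt0 ?invr_gt0.
move=> x y ax xy yb.
have fx : c <= f x by rewrite cf// (le_trans xy).
have fy : c <= f y by rewrite cf// (le_trans ax).
have fx0 := lt_le_trans c0 fx; have fy0 := lt_le_trans c0 fy.
have -> : (f y)^-1 - (f x)^-1 = ((f x)^-1 * (f y)^-1) * (f x - f y).
  rewrite mulrBr mulrAC mulVf ?gt_eqF// mul1r -mulrA mulVf ?gt_eqF//.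
  by rewrite mulr1.
rewrite normrM distrC ler_wpM2r// normrM !gtr0_norm ?invr_gt0//.
by apply: ler_pM; rewrite ?invr_ge0 ?(ltW fx0) ?(ltW fy0)// lef_pV2 ?posrE.
Qed.

(** The exponential is Lipschitz on []-oo, M]] with constant [exp M]. *)
Lemma ac_expR a b (M : R) f :
  (forall x, a <= x -> x <= b -> f x <= M) ->
  absolutely_continuous_on a b f ->
  absolutely_continuous_on a b (fun x => expR (f x)).
Proof.
move=> fM acf; apply: (ac_lipschitz a b (expR M) f) => //; first exact: expR_gt0.
have key (u v : R) : u <= v -> v <= M -> expR v - expR u <= expR M * (v - u).
  move=> uv vM.
  have -> : expR v - expR u = expR v * (1 - expR (u - v)).
    by rewrite mulrBr mulr1 -expRD subrKC.
  apply: ler_pM => //.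
  - by rewrite subr_ge0 -expR0 ler_expR subr_le0.
  - by rewrite ler_expR.
  - by have := expR_ge1Dx (u - v); lra.
move=> x y ax xy yb.
have fx : f x <= M by rewrite fM// (le_trans xy).
have fy : f y <= M by rewrite fM// (le_trans ax).
have [le|/ltW le] := leP (f x) (f y).
  by rewrite !ger0_norm ?subr_ge0 ?ler_expR//; exact: key.
rewrite (distrC (expR _)) (distrC (f y)).
by rewrite !ger0_norm ?subr_ge0 ?ler_expR//; exact: key.
Qed.

Lemma lebesgue_measure_itvoo (x y : R) : x <= y ->
  mu `]x, y[%classic = (y - x)%:E.
Proof.
move=> xy; rewrite lebesgue_measure_itv/= lte_fin.
by case: ltgtP xy => // -> _; rewrite subrr.
Qed.

(** Over disjoint intervals the increments of the primitive add up to at most the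
integral of [|f|] over their union, and the integral of an integrable function is
small on sets of small measure. *)
Lemma ac_integral a b f :
  leb.-integrable (`[a, b] : set (lebR R)) (EFin \o f) ->
  absolutely_continuous_on a b
    (fun x => \int[leb]_(t in (`[a, x] : set (lebR R))) f t).
Proof.
move=> intf e e0.
have [g [ig _ Fg]] := lebesgue_integrable_borel _ _ (measurable_itv `[a, b]) intf.
pose gr := g \_ `[a, b].
have igr : mu.-integrable setT (EFin \o gr).
  by rewrite -restrict_EFin; apply/integrable_restrict => //; rewrite setTI.
have [d [d0 H]] := integral_normr_continuous igr e0.
exists d => // m x y xy tr sd.
pose I i : set (measurableTypeR R) := `]x i, y i[%classic.
have mI i : measurable (I i) by exact: measurable_itv.
have mU : measurable (\big[setU/set0]_(i < m) I i) by exact: bigsetU_measurable.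
have Ugr : mu (\big[setU/set0]_(i < m) I i) = (\sum_(i < m) (y i - x i))%:E.
  rewrite (measure_bigsetU_ord _ _ mI tr) -sumEFin; apply: eq_bigr => i _.
  by apply: lebesgue_measure_itvoo; case: (xy i) => _ [].
have /(H _ mU) : (mu (\big[setU/set0]_(i < m) I i) < d%:E)%E.
  by rewrite Ugr lte_fin.
apply: le_lt_trans.
have iI i : mu.-integrable (I i) (EFin \o (fun t => `|gr t|)).
  by apply: integrableS (integrable_norm igr).
have -> : \int[mu]_(t in \big[setU/set0]_(i < m) I i) `|gr t| =
    \sum_(i < m) \int[mu]_(t in I i) `|gr t|.
  have mgr : measurable_fun (\big[setU/set0]_(i < m) I i)
      (EFin \o (fun t => `|gr t|)).
    apply: measurable_funTS; exact: measurable_int (integrable_norm igr).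
  have trI : trivIset [set` index_enum 'I_m] I by exact: sub_trivIset tr.
  rewrite /Rintegral (ge0_integral_bigsetU _ mI (index_enum_uniq _) trI mgr).
  2: by move=> t _; rewrite lee_fin.
  by rewrite sum_fine// => i _; exact: integrable_fin_num (iI i).
apply: ler_sum => i _.
have [axi [xyi yib]] := xy i.
have yab : `[a, y i] `<=` `[a, b] by apply: subset_itvl; rewrite bnd_simp.
have xab : `[a, x i] `<=` `[a, b].
  by apply: subset_itvl; rewrite bnd_simp (le_trans xyi).
rewrite !Fg//.
have Iab : I i `<=` `[a, b].
  by apply: subset_itvScc; rewrite bnd_simp.
rewrite Rintegral_itvB ?bnd_simp//; last by apply: integrableS ig.
rewrite -Rintegral_itv_bndo_bndc; last by apply: integrableS ig.
apply: (le_trans (le_normr_Rintegral _ _)) => //.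
  by apply: integrableS ig.
rewrite le_eqVlt; apply/orP; left; apply/eqP; apply: eq_Rintegral => t.
by rewrite inE => /Iab tab; rewrite /gr patchE mem_set.
Qed.

(** At the supremum [c] of the points of [[a, b]] where [S] holds, the step carries [S]
from a point to the left of [c] to [c] and, unless [c = b], beyond it. *)
Lemma real_induction a b (S : R -> Prop) : a <= b -> S a ->
  (forall c, a <= c -> c <= b -> exists2 h, 0 < h &
     forall x y, S x -> a <= x -> c - h < x -> x <= c ->
       c <= y -> y < c + h -> y <= b -> S y) ->
  S b.
Proof.
move=> ab Sa step.
pose A := [set x | [/\ a <= x, x <= b & S x]].
have A0 : A a by split.
have hA : has_sup A by split; [exists a | exists b => x []].
set c := sup A.
have ac : a <= c by apply: ub_le_sup => //; exists b => x [].
have cb : c <= b by apply: ge_sup; [exists a|move=> x []].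
have [h h0 H] := step c ac cb.
have [x [ax xb Sx] cx] := sup_adherent h0 hA.
have xc : x <= c by apply: ub_le_sup => //; exists b => z [].
pose y := Num.min b (c + h / 2).
have cy : c <= y by rewrite le_min cb lerDl ltW// divr_gt0.
have yh : y < c + h.
  by rewrite gt_min; apply/orP; right; rewrite ltrD2l ltr_pdivrMr// ltr_pMr// ltr1n.
have yb : y <= b by rewrite ge_min lexx.
have Sy := H x y Sx ax cx xc cy yh yb.
have yc : y <= c.
  by apply: ub_le_sup; [exists b => z []|split => //; exact: le_trans cy].
suff <- : y = b by [].
move: yc; rewrite /y ge_min => /orP[bc|]; last first.
  by rewrite gerDl leNgt divr_gt0.
by apply/min_idPl; rewrite (le_trans bc)// lerDl ltW// divr_gt0.
Qed.

End AbsoluteContinuity.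

(** * Monotonicity from the sign of the derivative almost everywhere *)

Section AcMonotone.
Context {R : realType}.
Implicit Types (a b : R) (f g h : R -> R).
Notation mu := (@lebesgue_measure R).

Lemma sum_length_le_measure (m : nat) (x y : 'I_m -> R) (U : set R) :
  open U -> (forall i, x i <= y i) -> (forall i, `]x i, y i[ `<=` U) ->
  trivIset setT (fun i : 'I_m => `]x i, y i[%classic) ->
  ((\sum_(i < m) (y i - x i))%:E <= mu U)%E.
Proof.
move=> oU xy IU tr.
have mI i : measurable (`]x i, y i[%classic : set (measurableTypeR R)).
  exact: measurable_itv.
rewrite -sumEFin.
have -> : (\sum_(i < m) (y i - x i)%:E)%E =
    mu (\big[setU/set0]_(i < m) `]x i, y i[%classic).
  rewrite (measure_bigsetU_ord _ _ mI tr); apply: eq_bigr => i _.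
  by apply/esym; exact: lebesgue_measure_itvoo.
apply: le_measure; rewrite ?inE.
- exact: bigsetU_measurable.
- exact: open_measurable.
- elim/big_ind: _ => [//|A B AU BU|i _ //]; by move=> t [/AU|/BU].
Qed.

(** The families of intervals met below are built one at a time from left to right,
as lists whose head is the rightmost interval; this turns such a list into an
indexed disjoint family, to which the modulus of absolute continuity [d] applies. *)
Lemma ac_chain a b (d e : R) g (U : set R) (s : seq (R * R)) :
  (forall (m : nat) (x y : 'I_m -> R),
      (forall i, a <= x i /\ x i <= y i /\ y i <= b) ->
      trivIset setT (fun i : 'I_m => `]x i, y i[%classic) ->
      \sum_(i < m) (y i - x i) < d ->
      \sum_(i < m) `|g (y i) - g (x i)| < e) ->
  open U -> (mu U < d%:E)%E ->
  pairwise (fun v u => u.2 <= v.1) s ->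
  {in s, forall u, [/\ a <= u.1, u.1 <= u.2, u.2 <= b & `]u.1, u.2[ `<=` U]} ->
  \sum_(u <- s) `|g u.2 - g u.1| < e.
Proof.
move=> H oU Ud /(pairwiseP (0, 0)) sp sH.
rewrite (big_nth (0, 0)) big_mkord.
have sn (i : 'I_(size s)) : nth (0, 0) s i \in s by rewrite mem_nth.
have tr : trivIset setT (fun i : 'I_(size s) =>
    `](nth (0, 0) s i).1, (nth (0, 0) s i).2[%classic).
  apply/trivIsetP => i j _ _ ij.
  wlog lt : i j ij / (i < j)%N.
    move=> W; case: (ltngtP i j) => [| |/val_inj] h; first exact: W.
    - by rewrite setIC; apply: W => //; rewrite eq_sym.
    - by rewrite h eqxx in ij.
  apply/seteqP; split => // t [] /=; rewrite !in_itv/= => /andP[t1 _] /andP[_ t2].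
  have := sp i j (ltn_ord i) (ltn_ord j) lt.
  by move=> /(lt_le_trans t2) /lt_trans /(_ t1); rewrite ltxx.
apply: H => //.
  by move=> i; have [? ? ? _] := sH _ (sn i).
rewrite -lte_fin; apply: le_lt_trans Ud.
apply: sum_length_le_measure => // i.
  by have [] := sH _ (sn i).
by have [] := sH _ (sn i).
Qed.

(** Cover the exceptional null set by an open [U] of measure less than [d].  Moving
from [a] to [b], near a point outside [U] the increment of [g] is at most [e1]
times the length, by differentiability; near a point of [U] the step is an interval
contained in [U], and the steps of this kind contribute less than [e1] together by
absolute continuity.  Real induction replaces a covering theorem. *)
Lemma ac_ae_nonincreasing a b g : a <= b -> absolutely_continuous_on a b g ->
  {ae leb, forall t : lebR R, a < (t : R) -> (t : R) < b ->
     derivable g (t : R) 1 /\ derive1 g (t : R) <= 0} ->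
  g b <= g a.
Proof.
move=> ab acg dg; apply/ler_addgt0Pr => e e0.
have ba0 : 0 < b - a + 1 by rewrite ltr_wpDl// subr_ge0.
(* so that [e1 * (b - a)], for the points outside [U], and [e1], for those of [U],
   add up to [e] *)
pose e1 := e / (b - a + 1).
have e10 : 0 < e1 by rewrite divr_gt0.
have [d d0 H] := acg _ e10.
pose N : set R := [set t | ~ (a < t -> t < b ->
     derivable g t 1 /\ derive1 g t <= 0)].
have N0 : leb.-negligible ((N `|` [set a]) `|` [set b] : set (lebR R)).
  have n1 (x : R) : leb.-negligible ([set x] : set (lebR R)).
    apply/lebesgue_negligible_borel; exists [set x]; split => //.
    exact: lebesgue_measure_set1.
  by do 2 (apply: negligibleU => //).
have [U [oU NU Ud]] := negligible_open_cover _ _ N0 d0.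
pose S x := exists s : seq (R * R),
  [/\ pairwise (fun v u => u.2 <= v.1) s,
    {in s, forall u, [/\ a <= u.1, u.1 <= u.2, u.2 <= x & `]u.1, u.2[ `<=` U]} &
    g x - g a <= e1 * (x - a) + \sum_(u <- s) `|g u.2 - g u.1|].
have : S b.
  apply: (real_induction a b S ab).
    by exists [::]; split => //; rewrite big_nil !subrr mulr0 addr0.
  move=> c ac cb; have [Uc|Uc] := pselect (U c).
    have [h /= h0 hU] := (@nbhs_ballP _ _ c U).1 (oU c Uc).
    exists h => // x y [s [ps sH sg]] ax chx xc cy ych yb.
    exists ((x, y) :: s); split => /=.
    - rewrite ps andbT; apply/allP => u /sH[_ _ ux _]; exact: ux.
    - move=> u; rewrite inE => /orP[/eqP ->|/sH[? ? ? ?]] /=; split => //.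
      + exact: le_trans cy.
      + move=> t /=; rewrite in_itv/= => /andP[xt ty]; apply: hU.
        rewrite /ball/= ltr_distlC; lra.
      + by rewrite (le_trans _ (le_trans xc cy)).
    - rewrite big_cons/=.
      have := ler_norm (g y - g x).
      have : e1 * (x - a) <= e1 * (y - a).
        by rewrite ler_wpM2l ?(ltW e10)// lerD2r (le_trans xc).
      lra.
  have nN : ~ N c by move=> Nc; apply: Uc; apply: NU; left; left.
  have ca : c != a by apply/eqP => h; apply: Uc; apply: NU; left; right.
  have nb : c != b by apply/eqP => h; apply: Uc; apply: NU; right.
  have [dc gc] : derivable g c 1 /\ derive1 g c <= 0.
    apply: (contrapT nN); first by rewrite lt_neqAle eq_sym ca.
    by rewrite lt_neqAle nb.
  have : (fun h : R => h^-1 *: (g (h *: 1 + c) - g c)) h @[h --> 0^'] --> derive1 g c.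
    by rewrite derive1E; exact: dc.
  move=> /cvgrPdist_lt /(_ _ e10) [h /= h0 hH].
  have slope (k : R) : k != 0 -> `|k| < h -> k^-1 * (g (k + c) - g c) <= e1.
    move=> k0 kh; have := hH k; rewrite /ball_/= sub0r normrN => /(_ kh k0).
    rewrite /= [k *: _]mulr1 distrC => /(le_lt_trans (ler_norm _)).
    rewrite /GRing.scale/=; lra.
  exists h => // x y [s [ps sH sg]] ax chx xc cy ych yb.
  exists s; split => //.
    move=> u /sH[? ? ux ?]; split => //.
    by rewrite (le_trans ux)// (le_trans xc).
  have right : g y - g c <= e1 * (y - c).
    have [->|yc] := eqVneq y c; first by rewrite !subrr mulr0.
    have yc0 : 0 < y - c by rewrite subr_gt0 lt_neqAle eq_sym yc.
    have := slope (y - c); rewrite subrK gtr0_norm// gt_eqF// mulrC.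
    rewrite ler_pdivrMr//; apply => //; lra.
  have left : g c - g x <= e1 * (c - x).
    have [->|xc'] := eqVneq x c; first by rewrite !subrr mulr0.
    have xc0 : x - c < 0 by rewrite subr_lt0 lt_neqAle xc'.
    have := slope (x - c); rewrite subrK ltr0_norm// lt_eqF// mulrC.
    rewrite ler_ndivrMr// => /(_ isT) HH.
    have : e1 * (x - c) <= g x - g c by apply: HH; lra.
    lra.
  move: right left; rewrite !mulrBr; move: sg; rewrite !mulrBr; lra.
move=> [s [ps sH sg]].
have := ac_chain a b d e1 g U s H oU Ud ps sH.
have : e1 * (b - a) + e1 = e.
  by rewrite /e1 -[X in _ + X]mulr1 -mulrDr divfK// gt_eqF.
lra.
Qed.

End AcMonotone.

(** * Integral inequalities from differential inequalities *)

Section IntervalIntegrals.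
Context {R : realType}.
Implicit Types (a b : R) (f g h : R -> R).
Notation mu := (@lebesgue_measure R).

Lemma integrable_subset (D E : set R) f : measurable (D : set (measurableTypeR R)) ->
  measurable (E : set (measurableTypeR R)) -> D `<=` E ->
  leb.-integrable (E : set (lebR R)) (EFin \o f) ->
  leb.-integrable (D : set (lebR R)) (EFin \o f).
Proof.
by move=> mD mE DE; apply: integrableS => //; exact: borel_lebesgue_measurable.
Qed.

Lemma integrable_subitv (a b c d : itv_bound R) f : (c <= a)%O -> (b <= d)%O ->
  leb.-integrable ([set` Interval c d] : set (lebR R)) (EFin \o f) ->
  leb.-integrable ([set` Interval a b] : set (lebR R)) (EFin \o f).
Proof.
move=> ca bd; apply: integrable_subset; [exact: measurable_itv|exact: measurable_itv|].
exact: subset_itv.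
Qed.

Lemma Rintegral_itv_split a (b : itv_bound R) (x : R) f :
  leb.-integrable ([set` Interval (BLeft a) b] : set (lebR R)) (EFin \o f) ->
  a <= x -> (BRight x <= b)%O ->
  \int[leb]_(t in ([set` Interval (BLeft a) b] : set (lebR R))) f t =
  \int[leb]_(t in (`[a, x] : set (lebR R))) f t +
  \int[leb]_(t in ([set` Interval (BLeft x) b] : set (lebR R))) f t.
Proof.
move=> intf ax xb.
have [g [ig _ Fg]] := lebesgue_integrable_borel _ _ (measurable_itv _) intf.
have xb' : (BLeft x <= b)%O by rewrite (le_trans _ xb)// bnd_simp.
have s1 : `[a, x] `<=` [set` Interval (BLeft a) b] by exact: subset_itvl.
have s2 : [set` Interval (BLeft x) b] `<=` [set` Interval (BLeft a) b].
  by apply: subset_itvr; rewrite bnd_simp.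
have s3 : [set` Interval (BRight x) b] `<=` [set` Interval (BLeft a) b].
  by apply: subset_itvr; rewrite bnd_simp.
rewrite !Fg//; try exact: measurable_itv.
rewrite -[X in _ = _ + X]Rintegral_itv_obnd_cbnd; last by apply: integrableS ig.
by rewrite -(Rintegral_itvB ig) ?bnd_simp// subrKC.
Qed.

Lemma locally_integrable_fromW a (c : R) f : a <= c ->
  locally_integrable_from a f -> locally_integrable_from c f.
Proof.
by move=> ac lf b; apply: integrable_subitv (lf b); rewrite bnd_simp.
Qed.

(** Monotone convergence along the intervals [[a, a + n]]. *)
Lemma integral_halfline_le a (K : R) f : locally_integrable_from a f ->
  (forall x, a <= x -> 0 <= f x) ->
  (forall b, a <= b -> \int[leb]_(t in (`[a, b] : set (lebR R))) f t <= K) ->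
  leb.-integrable (`[a, +oo[ : set (lebR R)) (EFin \o f) /\
  \int[leb]_(t in (`[a, +oo[ : set (lebR R))) f t <= K.
Proof.
move=> lf f0 fK.
pose F (n : nat) : set (lebR R) := `[a, a + n%:R]%classic.
have UF : \bigcup_n F n = `[a, +oo[%classic :> set R.
  apply/seteqP; split=> x.
    by case=> n _ /=; rewrite !in_itv/= andbT => /andP[].
  rewrite /= in_itv/= andbT => ax.
  exists (Num.truncn (x - a)).+1 => //; rewrite /F /= in_itv/= ax/=.
  by have := truncnS_gt (x - a); lra.
have mF n : measurable (F n) by exact: lebesgue_measurable_itv.
have ndF : {homo F : n m / (n <= m)%N >-> (n <= m)%O}.
  move=> n m nm; apply/subsetPset; apply: subset_itvl.
  by rewrite bnd_simp lerD2l ler_nat.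
have mf n : measurable_fun (F n) (EFin \o f) by exact: measurable_int (lf _).
have F0 n x : F n x -> (0 <= (EFin \o f) x)%E.
  by rewrite /F /= in_itv/= => /andP[ax _]; rewrite lee_fin f0.
have := @ge0_nondecreasing_set_cvg_integral _ _ _ F (EFin \o f) leb ndF mF mf F0.
rewrite UF => cv.
have le : (\int[leb]_(x in (`[a, +oo[ : set (lebR R))) (EFin \o f) x <= K%:E)%E.
  rewrite -(cvg_lim _ cv)//; apply: lime_le; first by apply/cvg_ex; eexists; exact: cv.
  apply: nearW => n.
  have := fK (a + n%:R); rewrite lerDl ler0n => /(_ isT).
  rewrite /Rintegral -lee_fin fineK//.
  apply: integrable_fin_num (lf _); exact: lebesgue_measurable_itv.
have mfU : measurable_fun (`[a, +oo[ : set (lebR R)) (EFin \o f).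
  by rewrite -UF; apply/measurable_fun_bigcup.
have f0' : forall x : lebR R, `[a, +oo[%classic (x : R) -> (0 <= (EFin \o f) x)%E.
  by move=> x /=; rewrite in_itv/= andbT => /f0; rewrite lee_fin.
have int : leb.-integrable (`[a, +oo[ : set (lebR R)) (EFin \o f).
  apply/integrableP; split => //; apply: le_lt_trans (ltry K).
  rewrite (le_trans _ le)// le_eqVlt; apply/orP; left; apply/eqP.
  by apply: eq_integral => x; rewrite inE => /f0' /gee0_abs.
split => //.
rewrite /Rintegral -lee_fin fineK//.
apply: integrable_fin_num int; exact: lebesgue_measurable_itv.
Qed.

Lemma ae_derivable_integral_bounded a b f :
  leb.-integrable (`[a, b] : set (lebR R)) (EFin \o f) ->
  {ae leb, forall x : lebR R, a < (x : R) -> (x : R) < b ->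
     is_derive (x : R) 1
       (fun x => \int[leb]_(t in (`[a, x] : set (lebR R))) f t) (f x)}.
Proof.
move=> intf; have := lebesgue_FTC1 a b f intf.
apply: (@filterS _ _ (ae_filter_ringOfSetsType leb)) => x /=.
by move=> H ax xb; have [d1 <-] := H ax xb; rewrite derive1E; exact: DeriveDef.
Qed.

(** [g] minus the primitive of [f] has a nonpositive derivative. *)
Lemma ac_le_integral a b f g : a <= b -> absolutely_continuous_on a b g ->
  leb.-integrable (`[a, b] : set (lebR R)) (EFin \o f) ->
  {ae leb, forall t : lebR R, a < (t : R) -> (t : R) < b ->
     derivable g (t : R) 1 /\ derive1 g (t : R) <= f t} ->
  g b - g a <= \int[leb]_(t in (`[a, b] : set (lebR R))) f t.
Proof.
move=> ab acg intf dg.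
have := ac_ae_nonincreasing a b _ ab (acB _ _ _ _ acg (ac_integral _ _ _ intf)).
have -> : \int[leb]_(t in (`[a, a] : set (lebR R))) f t = 0.
  have := Rintegral_itv_split a (BRight b) a f intf (lexx a).
  rewrite bnd_simp => /(_ ab); lra.
move=> H; suff : g b - \int[leb]_(t in (`[a, b] : set (lebR R))) f t <= g a - 0 by lra.
apply: H.
have := @filterI _ _ (ae_filter_ringOfSetsType leb) _ _ dg
  (ae_derivable_integral_bounded _ _ _ intf).
apply: (@filterS _ _ (ae_filter_ringOfSetsType leb)) => t [/= H1 H2] a_t t_b.
have [d1 D1] := H1 a_t t_b; have [d2 D2] := H2 a_t t_b.
split; first exact: derivableB.
by rewrite derive1E deriveB// D2 -derive1E subr_le0.
Qed.

Lemma ac_ge_integral a b f g : a <= b -> absolutely_continuous_on a b g ->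
  leb.-integrable (`[a, b] : set (lebR R)) (EFin \o f) ->
  {ae leb, forall t : lebR R, a < (t : R) -> (t : R) < b ->
     derivable g (t : R) 1 /\ f t <= derive1 g (t : R)} ->
  \int[leb]_(t in (`[a, b] : set (lebR R))) f t <= g b - g a.
Proof.
move=> ab acg intf dg.
have intN : leb.-integrable (`[a, b] : set (lebR R)) (EFin \o (fun x => - f x)).
  by have := integrableN intf; apply: eq_integrable => //; exact: lebesgue_measurable_itv.
have := ac_le_integral a b _ _ ab (acN _ _ _ acg) intN.
have -> : \int[leb]_(t in (`[a, b] : set (lebR R))) - f t =
    - \int[leb]_(t in (`[a, b] : set (lebR R))) f t.
  have mab := lebesgue_measurable_itv `[a, b].
  rewrite -mulN1r -RintegralZl//.
  by apply: eq_Rintegral => t _; rewrite mulN1r.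
move=> H; suff : - g b - - g a <= - \int[leb]_(t in (`[a, b] : set (lebR R))) f t by lra.
apply: H; apply: (@filterS _ _ (ae_filter_ringOfSetsType leb)) dg => t H a_t t_b.
have [d1 D1] := H a_t t_b; split; first exact: derivableN.
by rewrite derive1E deriveN// -derive1E lerN2.
Qed.

Lemma ae_is_derive_integral a f : locally_integrable_from a f ->
  {ae leb, forall x : lebR R, a < (x : R) ->
     is_derive (x : R) 1
       (fun x => \int[leb]_(t in (`[a, x] : set (lebR R))) f t) (f x)}.
Proof.
move=> lf.
have /negligible_bigcup : forall n : nat, leb.-negligible
    (~` [set x : lebR R | a < (x : R) -> (x : R) < n%:R ->
     is_derive (x : R) 1
       (fun x => \int[leb]_(t in (`[a, x] : set (lebR R))) f t) (f x)]).
  by move=> n; exact: ae_derivable_integral_bounded (lf n%:R).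
apply: negligibleS => x /= H; apply: contrapT => H'.
apply: H => ax; apply: contrapT => H2; apply: H'.
exists (Num.truncn (x : R)).+1 => //= H3; apply: H2; apply: H3 => //.
exact: truncnS_gt.
Qed.

Lemma ae_neq (a : R) : {ae leb, forall x : lebR R, (x : R) != a}.
Proof.
apply/lebesgue_ae_borel; exists [set a]; split => //.
  exact: lebesgue_measure_set1.
by move=> x /= /negP; rewrite negbK => /eqP.
Qed.

End IntervalIntegrals.

(** * The Riccati integral equation *)

Section Riccati.
Context {R : realType}.
Implicit Types (a b T : R) (f g h Q w u v r : R -> R).

(** Freezing [f] to the left of [T] makes it monotone on the whole line. *)
Lemma measurable_nonincreasing_from T f :
  (forall x y, T <= x -> x <= y -> f y <= f x) ->
  measurable_fun (`[T, +oo[ : set (lebR R)) (f : lebR R -> R).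
Proof.
move=> ni.
have mg : measurable_fun (setT : set (lebR R))
    ((fun x => f (Num.max T x)) : lebR R -> R).
  apply: borel_lebesgue_measurable_fun => //.
  apply: nonincreasing_measurable => // x y xy.
  apply: ni; first by rewrite le_max lexx.
  by rewrite ge_max !le_max lexx/= xy orbT.
apply: eq_measurable_fun (measurable_funTS mg) => x.
by rewrite inE/= in_itv/= andbT => /max_idPr ->.
Qed.

(** Where the integral converges, a fixed point in [v] is a solution of
[u' + Q + w u^2 = 0] that tends to [0] at infinity. *)
Definition riccati_operator Q w v t : R :=
  \int[leb]_(s in (`[t, +oo[ : set (lebR R))) (Q s + v s ^+ 2 * w s).

(** The Knaster-Tarski fixed point: [u] is the pointwise supremum of the nonincreasing
[v] with [0 <= v <= r] and [v <= Phi v], where [Phi] is the operator.  Monotone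
functions are closed under arbitrary suprema, so [u] is measurable even though the
family is uncountable, and no passage to the limit under the integral is needed. *)
Lemma riccati_fixed_point T Q w r :
  (forall t, T <= t -> 0 <= Q t) -> (forall t, T <= t -> 0 <= w t) ->
  (forall t, T <= t -> 0 <= r t) ->
  measurable_fun (`[T, +oo[ : set (lebR R)) (w : lebR R -> R) ->
  leb.-integrable (`[T, +oo[ : set (lebR R)) (EFin \o Q) ->
  leb.-integrable (`[T, +oo[ : set (lebR R)) (EFin \o (fun t => r t ^+ 2 * w t)) ->
  (forall t, T <= t -> riccati_operator Q w r t <= r t) ->
  exists u, [/\ forall t, T <= t -> 0 <= u t,
    forall x y, T <= x -> x <= y -> u y <= u x,
    leb.-integrable (`[T, +oo[ : set (lebR R)) (EFin \o (fun t => Q t + u t ^+ 2 * w t)) &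
    forall t, T <= t -> u t = riccati_operator Q w u t].
Proof.
move=> Q0 w0 r0 mw intQ intr rr.
have mT := lebesgue_measurable_itv `[T, +oo[.
pose adm v := (forall x y, T <= x -> x <= y -> v y <= v x) /\
  (forall t, T <= t -> 0 <= v t <= r t).
pose intg v := leb.-integrable (`[T, +oo[ : set (lebR R))
  (EFin \o (fun t => Q t + v t ^+ 2 * w t)).
have intD (v : R -> R) :
    leb.-integrable (`[T, +oo[ : set (lebR R)) (EFin \o (fun t => v t ^+ 2 * w t)) ->
    intg v.
  by move=> iv; apply: eq_integrable (integrableD mT intQ iv).
have intR : intg r by exact: intD.
have sq_le (v1 v2 : R -> R) t : T <= t -> 0 <= v1 t <= v2 t ->
    v1 t ^+ 2 * w t <= v2 t ^+ 2 * w t.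
  move=> Tt /andP[v10 v12]; rewrite ler_wpM2r ?w0// ler_pXn2r// nnegrE//.
  exact: le_trans v12.
have adm_int v : adm v -> intg v.
  move=> [niv vr]; apply: intD; apply: le_integrable intr => //.
    apply/measurable_EFinP; apply: measurable_funM; last exact: mw.
    by apply: measurable_funX; exact: measurable_nonincreasing_from.
  move=> t /=; rewrite in_itv/= andbT => Tt; rewrite lee_fin.
  have E (v' : R -> R) : `|v' t ^+ 2 * w t| = v' t ^+ 2 * w t.
    by rewrite ger0_norm// mulr_ge0 ?sqr_ge0// w0.
  by rewrite !E; exact: (sq_le v r t Tt (vr t Tt)).
have op_le v1 v2 t : T <= t -> intg v1 -> intg v2 ->
    (forall s, T <= s -> 0 <= v1 s <= v2 s) ->
    riccati_operator Q w v1 t <= riccati_operator Q w v2 t.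
  move=> Tt i1 i2 v12; apply: le_Rintegral.
  - exact: lebesgue_measurable_itv.
  - by apply: integrable_subitv i1; rewrite ?bnd_simp.
  - by apply: integrable_subitv i2; rewrite ?bnd_simp.
  - move=> s /=; rewrite in_itv/= andbT => ts; rewrite lerD2l.
    have Ts := le_trans Tt ts; exact: (sq_le v1 v2 s Ts (v12 s Ts)).
have op_adm v : adm v -> adm (riccati_operator Q w v).
  move=> av; have iv := adm_int v av; have [niv vr] := av.
  have V0 s : T <= s -> 0 <= Q s + v s ^+ 2 * w s.
    by move=> Ts; rewrite addr_ge0 ?Q0// mulr_ge0 ?w0// sqr_ge0.
  split=> [x y Tx xy|t Tt].
    rewrite {2}/riccati_operator (Rintegral_itv_split x +oo%O y)//.
      rewrite lerDr; apply: Rintegral_ge0 => s /=; rewrite in_itv/= => /andP[xs _].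
      exact/V0/(le_trans Tx).
    by apply: integrable_subitv iv; rewrite ?bnd_simp.
  apply/andP; split.
    apply: Rintegral_ge0 => s /=; rewrite in_itv/= => /andP[ts _].
    exact/V0/(le_trans Tt).
  by apply: le_trans (rr t Tt); exact: op_le.
pose S := [set v | adm v /\ forall t, T <= t -> v t <= riccati_operator Q w v t].
have S0 : S (fun=> 0).
  have a0 : adm (fun=> 0) by split => // t Tt; rewrite lexx r0.
  by split => // t Tt; have [_ /(_ t Tt)/andP[]] := op_adm _ a0.
pose V t := [set v t | v in S].
pose u t := sup (V t).
have V0 t : V t !=set0 by exists 0, (fun=> 0).
have Vub t : T <= t -> ubound (V t) (r t).
  by move=> Tt _ [v [[_ /(_ t Tt)/andP[_ ?]] _] <-].
have Su v t : T <= t -> S v -> v t <= u t.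
  by move=> Tt Sv; apply: ub_le_sup; [exists (r t); exact: Vub|exists v].
have au : adm u.
  split=> [x y Tx xy|t Tt].
    apply: ge_sup => // _ [v Sv <-]; apply: le_trans (Su v x Tx Sv).
    by have [[ni _] _] := Sv; exact: ni.
  by rewrite (Su _ _ Tt S0)/=; apply: ge_sup => //; exact: Vub.
have iu := adm_int u au.
have u_op t : T <= t -> u t <= riccati_operator Q w u t.
  move=> Tt; apply: ge_sup => // _ [v Sv <-].
  have [av vop] := Sv; apply: le_trans (vop t Tt) _.
  apply: op_le => //; first exact: adm_int.
  move=> s Ts; rewrite (Su v s Ts Sv) andbT.
  by have [_ /(_ s Ts)/andP[]] := av.
exists u; split => //.
- by move=> t Tt; have [_ /(_ t Tt)/andP[]] := au.
- by case: au.
move=> t Tt; apply/eqP; rewrite eq_le u_op//=; apply: Su => //.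
split; first exact: op_adm.
move=> s Ts; apply: op_le => //; first exact/adm_int/op_adm.
move=> x Tx; rewrite u_op// andbT.
by have [_ /(_ x Tx)/andP[]] := au.
Qed.

(** [y = exp (int_T u / p)] satisfies [p y' = u y], and
[(u y)' = - (Q + u^2 / p) y + u^2 y / p = - Q y]. *)
Lemma riccati_positive_solution T p Q u :
  (forall t, T <= t -> 0 < p t) ->
  (forall t, T <= t -> 0 <= Q t) ->
  locally_integrable_from T (fun t => (p t)^-1) ->
  (forall t, T <= t -> 0 <= u t) ->
  (forall x y, T <= x -> x <= y -> u y <= u x) ->
  leb.-integrable (`[T, +oo[ : set (lebR R))
    (EFin \o (fun t => Q t + u t ^+ 2 * (p t)^-1)) ->
  (forall t, T <= t -> u t = riccati_operator Q (fun s => (p s)^-1) u t) ->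
  exists y : R -> R, [/\ forall t, 0 < y t, locally_absolutely_continuous_from T y &
    second_order_equation_from T p y (fun t => Q t * y t)].
Proof.
move=> p0 Q0 ip u0 niu intV uE.
pose w t := (p t)^-1.
have w0 t : T <= t -> 0 <= w t by move=> Tt; rewrite invr_ge0 ltW// p0.
pose V t := Q t + u t ^+ 2 * w t.
have V0 s : T <= s -> 0 <= V s.
  by move=> Ts; rewrite addr_ge0 ?Q0// mulr_ge0 ?w0// sqr_ge0.
have iV : locally_integrable_from T V.
  by move=> b; apply: integrable_subitv intV; rewrite ?bnd_simp.
have iuw : locally_integrable_from T (fun t => u t * w t).
  move=> b; have iuTw : leb.-integrable (`[T, b] : set (lebR R))
      (EFin \o (fun t => u T * w t)).
    have := integrableZl (lebesgue_measurable_itv `[T, b]) (u T) (ip b).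
    by apply: eq_integrable => //; exact: lebesgue_measurable_itv.
  apply: le_integrable iuTw; first exact: lebesgue_measurable_itv.
    apply/measurable_EFinP; apply: measurable_funM; last first.
      by apply/measurable_EFinP; exact: measurable_int (ip b).
    have mT := lebesgue_measurable_itv `[T, +oo[.
    apply: measurable_funS (measurable_nonincreasing_from T u niu) => //.
    by apply: subset_itvl; rewrite bnd_simp.
  move=> t /=; rewrite in_itv/= => /andP[Tt _]; rewrite lee_fin.
  rewrite !ger0_norm ?mulr_ge0 ?u0 ?w0//.
  by rewrite ler_wpM2r ?w0// niu.
pose W t := \int[leb]_(s in (`[T, t] : set (lebR R))) (u s * w s).
pose J t := \int[leb]_(s in (`[T, t] : set (lebR R))) V s.
have uJ t : T <= t -> u t = u T - J t.
  move=> Tt; rewrite (uE t Tt) (uE T (lexx T)) /riccati_operator.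
  rewrite (Rintegral_itv_split T +oo%O t)//.
  by rewrite /J /V /w [in RHS]addrAC subrr add0r.
have Wmono s t : T <= s -> s <= t -> W s <= W t.
  move=> Ts st; rewrite {2}/W (Rintegral_itv_split T (BRight t) s)//.
  rewrite lerDl; apply: Rintegral_ge0 => x /=; rewrite in_itv/= => /andP[sx _].
  by rewrite mulr_ge0 ?u0 ?w0// (le_trans Ts).
pose y t := expR (W t).
have acy b : absolutely_continuous_on T b y.
  apply: (ac_expR T b (W b)); first by move=> x Tx xb; exact: Wmono.
  exact: ac_integral.
exists y; split => //; first by move=> t; exact: expR_gt0.
(* [u T - J] equals [u] to the right of [T], and it is a primitive on the whole line. *)
exists (fun t => (u T - J t) * y t); split.
- move=> b; apply: (ac_bounded_mul T b (u T) (expR (W b))) => //.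
  + move=> x Tx xb; rewrite -uJ// ger0_norm ?u0//; exact: niu.
  + by move=> x Tx xb; rewrite (ger0_norm (expR_ge0 _)) ler_expR; exact: Wmono.
  + apply: (ac_lipschitz T b 1 J) => //; first exact: ac_integral.
    move=> x z _ _ _; rewrite mul1r distrC.
    have -> : u T - J x - (u T - J z) = J z - J x by ring.
    exact: lexx.
- apply: (@filterS2 _ _ (ae_filter_ringOfSetsType leb) _ _ _ _
    (ae_is_derive_integral _ _ iuw) (ae_neq T)) => t Wt tT Tt.
  have {}Tt' : T < t by rewrite lt_neqAle eq_sym tT.
  have dW := Wt Tt'.
  have dy : is_derive (t : R) 1 y (expR (W t) * (u t * w t)).
    exact: is_derive1_comp.
  split; first exact: ex_derive.
  rewrite derive1E derive_val -uJ// /y /w; have := p0 t Tt => pt.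
  by field; rewrite gt_eqF.
- have F1 := @filterI _ _ (ae_filter_ringOfSetsType leb) _ _
    (ae_is_derive_integral _ _ iuw) (ae_is_derive_integral _ _ iV).
  apply: (@filterS2 _ _ (ae_filter_ringOfSetsType leb) _ _ _ _ F1 (ae_neq T))
    => t [/= Wt Jt] tT Tt.
  have {}Tt' : T < t by rewrite lt_neqAle eq_sym tT.
  have dW := Wt Tt'; have dJ := Jt Tt'.
  have dy : is_derive (t : R) 1 y (expR (W t) * (u t * w t)).
    exact: is_derive1_comp.
  have dpsi : is_derive (t : R) 1 ((cst (u T) - J) * y)
      ((cst (u T) - J) (t : R) *: (expR (W t) * (u t * w t)) + y t *: (0 - V t)).
    have dc : is_derive (t : R) 1 (cst (u T) - J) (0 - V t).
      exact: is_deriveB.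
    exact: is_deriveM.
  split; first exact: (@ex_derive _ _ _ _ _ _ _ dpsi).
  have := @derive_val _ _ _ _ _ _ _ dpsi; rewrite -derive1E => ->.
  have -> : (cst (u T) - J) (t : R) = u t by rewrite (uJ t Tt).
  rewrite /GRing.scale/= /V /y; ring.
Qed.

End Riccati.

(** * Positive solutions of the equation with a nonnegative forcing term *)

Section PositiveSolutions.
Context {R : realType}.
Implicit Types (T a b s t : R) (p phi psi F Q f h : R -> R).

(** Unlike [second_order_equation_from], which hides it, this names the locally
absolutely continuous version [psi] of [p phi'], about which most of the argument
speaks. *)
Definition solution_pair T p phi psi F : Prop :=
  [/\ locally_absolutely_continuous_from T phi,
      locally_absolutely_continuous_from T psi,
      {ae leb, forall t : lebR R, T <= (t : R) ->
         derivable phi (t : R) 1 /\ psi t = p t * derive1 phi (t : R)} &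
      {ae leb, forall t : lebR R, T <= (t : R) ->
         derivable psi (t : R) 1 /\ derive1 psi (t : R) + F t = 0}].

Lemma solution_pairW T T' p phi psi F : T <= T' ->
  solution_pair T p phi psi F -> solution_pair T' p phi psi F.
Proof.
move=> TT' [h1 h2 h3 h4]; split.
- by move=> b; apply: ac_subitv (h1 b).
- by move=> b; apply: ac_subitv (h2 b).
- by apply: (@filterS _ _ (ae_filter_ringOfSetsType leb)) h3 => t H /(le_trans TT')/H.
- by apply: (@filterS _ _ (ae_filter_ringOfSetsType leb)) h4 => t H /(le_trans TT')/H.
Qed.

Section Fixed.
Variables (T : R) (p phi psi F : R -> R).
Hypothesis sol : solution_pair T p phi psi F.
Hypothesis p0 : forall t, T <= t -> 0 < p t.
Hypothesis ip : locally_integrable_from T (fun t => (p t)^-1).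
Hypothesis pinf : forall s K, T <= s -> exists2 t, s <= t &
  K < \int[leb]_(x in (`[s, t] : set (lebR R))) (p x)^-1.
Hypothesis F0 : forall t, T <= t -> 0 <= F t.
Hypothesis phi0 : forall t, T <= t -> 0 < phi t.

Let w0 t : T <= t -> 0 <= (p t)^-1.
Proof. by move=> Tt; rewrite invr_ge0 ltW// p0. Qed.

Let ip' a b : T <= a ->
  leb.-integrable (`[a, b] : set (lebR R)) (EFin \o (fun t => (p t)^-1)).
Proof. by move=> Ta; exact: locally_integrable_fromW Ta ip b. Qed.

Let icp (c : R) a b : T <= a ->
  leb.-integrable (`[a, b] : set (lebR R)) (EFin \o (fun t => c * (p t)^-1)).
Proof.
move=> Ta.
have := integrableZl (lebesgue_measurable_itv `[a, b]) c (ip' a b Ta).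
by apply: eq_integrable => //; exact: lebesgue_measurable_itv.
Qed.

Let Icp (c : R) a b : T <= a ->
  \int[leb]_(x in (`[a, b] : set (lebR R))) (c * (p x)^-1) =
  c * \int[leb]_(x in (`[a, b] : set (lebR R))) (p x)^-1.
Proof.
move=> Ta; apply: RintegralZl; first exact: lebesgue_measurable_itv.
exact: ip'.
Qed.

Let psiE : {ae leb, forall t : lebR R, T <= (t : R) ->
  derivable phi (t : R) 1 /\ derive1 phi (t : R) = psi t * (p t)^-1}.
Proof.
have [_ _ h3 _] := sol.
apply: (@filterS _ _ (ae_filter_ringOfSetsType leb)) h3 => t H Tt.
have [dphi ->] := H Tt; split => //.
by rewrite mulrAC divff ?mul1r// gt_eqF// p0.
Qed.

Let acphi a b : T <= a -> absolutely_continuous_on a b phi.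
Proof. by have [h1 _ _ _] := sol; move=> Ta; apply: ac_subitv (h1 b). Qed.

Let acpsi a b : T <= a -> absolutely_continuous_on a b psi.
Proof. by have [_ h2 _ _] := sol; move=> Ta; apply: ac_subitv (h2 b). Qed.

Lemma quasiderivative_nonincreasing s t : T <= s -> s <= t -> psi t <= psi s.
Proof.
move=> Ts st; apply: ac_ae_nonincreasing => //; first exact: acpsi.
have [_ _ _ h4] := sol.
apply: (@filterS _ _ (ae_filter_ringOfSetsType leb)) h4 => x H sx _.
have Tx : T <= x by rewrite (le_trans Ts)// ltW.
by have [d E] := H Tx; split => //; have := F0 x Tx; lra.
Qed.

Lemma increment_le_quasiderivative s t : T <= s -> s <= t ->
  phi t - phi s <= psi s * \int[leb]_(x in (`[s, t] : set (lebR R))) (p x)^-1.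
Proof.
move=> Ts st; rewrite -Icp//; apply: ac_le_integral => //.
- exact: acphi.
- exact: icp.
- apply: (@filterS _ _ (ae_filter_ringOfSetsType leb)) psiE => x H sx _.
  have Tx : T <= x by rewrite (le_trans Ts)// ltW.
  have [d ->] := H Tx; split => //.
  rewrite ler_wpM2r ?w0//.
  by apply: quasiderivative_nonincreasing => //; exact: ltW.
Qed.

Lemma increment_ge_quasiderivative s t : T <= s -> s <= t ->
  psi t * \int[leb]_(x in (`[s, t] : set (lebR R))) (p x)^-1 <= phi t - phi s.
Proof.
move=> Ts st; rewrite -Icp//; apply: ac_ge_integral => //.
- exact: acphi.
- exact: icp.
- apply: (@filterS _ _ (ae_filter_ringOfSetsType leb)) psiE => x H sx xt.
  have Tx : T <= x by rewrite (le_trans Ts)// ltW.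
  have [d ->] := H Tx; split => //.
  rewrite ler_wpM2r ?w0//.
  by apply: quasiderivative_nonincreasing => //; exact: ltW.
Qed.

(** If [psi s < 0] then [phi] stays below [phi s + psi s * int_s 1/p], which becomes
negative. *)
Lemma quasiderivative_ge0 s : T <= s -> 0 <= psi s.
Proof.
move=> Ts; rewrite leNgt; apply/negP => neg.
have [t st Kt] := pinf s (phi s / - psi s) Ts.
have := increment_le_quasiderivative s t Ts st.
have := phi0 t (le_trans Ts st).
move: Kt; rewrite ltr_pdivrMr ?oppr_gt0//.
set I := \int[leb]_(x in _) _; lra.
Qed.

Lemma positive_solution_nondecreasing s t : T <= s -> s <= t -> phi s <= phi t.
Proof.
move=> Ts st; rewrite -subr_ge0.
apply: le_trans (increment_ge_quasiderivative s t Ts st).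
rewrite mulr_ge0 ?quasiderivative_ge0// ?(le_trans Ts)//.
apply: Rintegral_ge0 => x /=; rewrite in_itv/= => /andP[sx _].
by rewrite w0// (le_trans Ts).
Qed.

(** [phi] is a concave function of [P = int_T 1/p] and is positive at [T], where [P]
vanishes; so [phi / P] is nonincreasing, which is multiplied out here to cover [T]. *)
Lemma positive_solution_ratio s t : T <= s -> s <= t ->
  phi t * \int[leb]_(x in (`[T, s] : set (lebR R))) (p x)^-1 <=
  phi s * \int[leb]_(x in (`[T, t] : set (lebR R))) (p x)^-1.
Proof.
move=> Ts st.
rewrite (Rintegral_itv_split T (BRight t) s) ?bnd_simp//.
have := increment_le_quasiderivative s t Ts st.
have := increment_ge_quasiderivative T s (lexx T) Ts.
have : 0 <= \int[leb]_(x in (`[T, s] : set (lebR R))) (p x)^-1.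
  apply: Rintegral_ge0 => x /=; rewrite in_itv/= => /andP[sx _].
  by rewrite w0.
have : 0 <= \int[leb]_(x in (`[s, t] : set (lebR R))) (p x)^-1.
  apply: Rintegral_ge0 => x /=; rewrite in_itv/= => /andP[sx _].
  by rewrite w0// (le_trans Ts).
have := phi0 T (lexx T).
set A := \int[leb]_(x in _) _; set B := \int[leb]_(x in _) _.
move=> phT B0 A0 H1 H2.
have : (phi t - phi s) * B <= psi s * A * B by rewrite ler_wpM2r.
have : psi s * B * A <= phi s * A by rewrite ler_wpM2r//; lra.
rewrite mulrDr mulrBl; lra.
Qed.

(** After [s], [psi] loses at least [phi s] times the integral of [Q], since
[psi' = - F <= - Q * phi s], and yet it remains nonnegative. *)
Lemma quasiderivative_ge_tail (Q : R -> R) s : T <= s ->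
  locally_integrable_from s Q -> (forall t, s <= t -> 0 <= Q t) ->
  (forall t, s <= t -> Q t * phi s <= F t) ->
  \int[leb]_(x in (`[s, +oo[ : set (lebR R))) Q x <= psi s / phi s.
Proof.
move=> Ts iQ Q0 QF; have ph := phi0 s Ts.
apply: (integral_halfline_le _ _ _ iQ Q0 _).2 => b sb.
rewrite ler_pdivlMr//.
have mI := lebesgue_measurable_itv `[s, b].
have -> : \int[leb]_(x in (`[s, b] : set (lebR R))) Q x * phi s =
    \int[leb]_(x in (`[s, b] : set (lebR R))) (phi s * Q x).
  by rewrite mulrC RintegralZl.
have iphiQ : leb.-integrable (`[s, b] : set (lebR R)) (EFin \o (fun x => phi s * Q x)).
  by have := integrableZl mI (phi s) (iQ b); apply: eq_integrable.
apply: (@le_trans _ _ ((- psi b) - (- psi s))); last first.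
  have := quasiderivative_ge0 b (le_trans Ts sb); lra.
apply: (ac_ge_integral s b (fun x => phi s * Q x) (fun x => - psi x)) => //.
  exact/acN/acpsi.
have [_ _ _ h4] := sol.
apply: (@filterS _ _ (ae_filter_ringOfSetsType leb)) h4 => x H sx _.
have Tx : T <= x by rewrite (le_trans Ts)// ltW.
have [d E] := H Tx; split; first exact: derivableN.
by rewrite derive1E deriveN// -derive1E; have := QF x (ltW sx); lra.
Qed.

(** [phi * exp (- int_s h)] is nondecreasing. *)
Lemma positive_solution_growth h s t : T <= s -> s <= t ->
  leb.-integrable (`[s, t] : set (lebR R)) (EFin \o h) ->
  (forall x, s <= x -> 0 <= h x) ->
  (forall x, s <= x -> h x <= (p x)^-1 * (psi x / phi x)) ->
  phi s * expR (\int[leb]_(x in (`[s, t] : set (lebR R))) h x) <= phi t.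
Proof.
move=> Ts st ih h0 hle.
pose H x := \int[leb]_(z in (`[s, x] : set (lebR R))) h z.
have acH : absolutely_continuous_on s t H by exact: ac_integral.
have H0 x : 0 <= H x.
  by apply: Rintegral_ge0 => z /=; rewrite in_itv/= => /andP[sz _]; exact: h0.
have Hs : H s = 0.
  have := Rintegral_itv_split s (BRight t) s h ih (lexx s).
  by rewrite bnd_simp => /(_ st); rewrite /H; lra.
pose E x := expR (- H x).
have E1 x : `|E x| <= 1.
  by rewrite (ger0_norm (expR_ge0 _)) -expR0 ler_expR oppr_le0.
have acE : absolutely_continuous_on s t E.
  by apply: (ac_expR s t 0); [move=> x _ _; rewrite oppr_le0|exact: acN].
have acg : absolutely_continuous_on s t (fun x => phi x * E x).
  apply: (ac_bounded_mul s t (phi t) 1) => //; last exact: acphi.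
  move=> x sx xt; have Tx := le_trans Ts sx; rewrite gtr0_norm ?phi0//.
  exact: positive_solution_nondecreasing.
have := ac_ae_nonincreasing s t _ st (acN _ _ _ acg).
rewrite lerN2 /E Hs oppr0 expR0 mulr1 expRN -/(H t) => key.
rewrite -ler_pdivlMr ?expR_gt0//; apply: key.
apply: (@filterS2 _ _ (ae_filter_ringOfSetsType leb) _ _ _ _
  psiE (ae_derivable_integral_bounded _ _ _ ih)) => x dphi dH sx xt.
have Tx : T <= x by rewrite (le_trans Ts)// ltW.
have [d1 D1] := dphi Tx; have dHx := dH sx xt.
have dph : is_derive (x : R) 1 phi (psi x * (p x)^-1).
  by rewrite -D1 derive1E; exact: DeriveDef.
have dNH : is_derive (x : R) 1 (- H) (- h x) by exact: is_deriveN.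
have dE : is_derive (x : R) 1 E (expR (- H x) * - h x).
  by apply: (@is_derive1_comp _ expR (- H)).
have dg : is_derive (x : R) 1 (- (phi * E))
    (- (phi x *: (expR (- H x) * - h x) + E x *: (psi x * (p x)^-1))).
  by apply: is_deriveN; exact: is_deriveM.
split; first exact: (@ex_derive _ _ _ _ _ _ _ dg).
have := @derive_val _ _ _ _ _ _ _ dg; rewrite -derive1E => ->.
rewrite /GRing.scale/= /E oppr_le0.
have -> : phi x * (expR (- H x) * - h x) + expR (- H x) * (psi x * (p x)^-1) =
  expR (- H x) * (psi x * (p x)^-1 - phi x * h x) by ring.
rewrite mulr_ge0 ?expR_ge0// subr_ge0.
have := hle x (ltW sx); rewrite mulrA ler_pdivlMr ?phi0//; lra.
Qed.

(** The quotient [r = psi / phi] satisfies [r' = - F / phi - r^2 / p <= - (Q + r^2 / p)],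
and it remains nonnegative, so its value at [t] bounds the integral over [[t, +oo[]. *)
Lemma riccati_inequality Q : locally_integrable_from T Q ->
  (forall t, T <= t -> 0 <= Q t) ->
  (forall t, T <= t -> Q t * phi t <= F t) ->
  [/\ leb.-integrable (`[T, +oo[ : set (lebR R)) (EFin \o Q),
    leb.-integrable (`[T, +oo[ : set (lebR R))
      (EFin \o (fun t => (psi t / phi t) ^+ 2 * (p t)^-1)) &
    forall t, T <= t ->
      riccati_operator Q (fun s => (p s)^-1) (fun s => psi s / phi s) t <=
      psi t / phi t].
Proof.
move=> iQ Q0 QF.
pose r t := psi t / phi t.
have r0 t : T <= t -> 0 <= r t.
  by move=> Tt; rewrite divr_ge0 ?quasiderivative_ge0// ltW// phi0.
have rmono x y : T <= x -> x <= y -> r y <= r x.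
  move=> Tx xy; have Ty := le_trans Tx xy; apply: ler_pM.
  - exact: quasiderivative_ge0.
  - by rewrite invr_ge0 ltW// phi0.
  - exact: quasiderivative_nonincreasing.
  - by rewrite lef_pV2 ?posrE ?phi0//; exact: positive_solution_nondecreasing.
have ir : locally_integrable_from T (fun t => r t ^+ 2 * (p t)^-1).
  move=> b; apply: le_integrable (icp (r T ^+ 2) T b (lexx T)).
  - exact: lebesgue_measurable_itv.
  - apply/measurable_EFinP; apply: measurable_funM; last first.
      by apply/measurable_EFinP; exact: measurable_int (ip b).
    apply: measurable_funX.
    have mT := lebesgue_measurable_itv `[T, +oo[.
    apply: measurable_funS (measurable_nonincreasing_from T r rmono) => //.
    by apply: subset_itvl; rewrite bnd_simp.
  move=> t /=; rewrite in_itv/= => /andP[Tt _]; rewrite lee_fin.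
  have pos (x : R) : 0 <= x ^+ 2 * (p t)^-1 by rewrite mulr_ge0 ?sqr_ge0 ?w0.
  rewrite (ger0_norm (pos _)) (ger0_norm (pos _)).
  by rewrite ler_wpM2r ?w0// ler_pXn2r ?nnegrE ?r0// rmono.
pose V t := Q t + r t ^+ 2 * (p t)^-1.
have V0 t : T <= t -> 0 <= V t.
  by move=> Tt; rewrite addr_ge0 ?Q0// mulr_ge0 ?w0// sqr_ge0.
have iV : locally_integrable_from T V.
  move=> b; have mI := lebesgue_measurable_itv `[T, b].
  by apply: eq_integrable (integrableD mI (iQ b) (ir b)).
have acr a b : T <= a -> absolutely_continuous_on a b r.
  move=> Ta; apply: (ac_bounded_mul a b (psi a) (phi a)^-1).
  - move=> x ax xb; rewrite ger0_norm.
      exact: quasiderivative_nonincreasing.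
    by rewrite quasiderivative_ge0// (le_trans Ta).
  - move=> x ax xb; have Tx := le_trans Ta ax.
    rewrite gtr0_norm ?invr_gt0 ?phi0// lef_pV2 ?posrE ?phi0//.
    exact: positive_solution_nondecreasing.
  - exact: acpsi.
  - apply: (ac_inv a b (phi a)); [exact: phi0| |exact: acphi].
    by move=> x ax _; exact: positive_solution_nondecreasing.
have key t b : T <= t -> t <= b ->
    \int[leb]_(x in (`[t, b] : set (lebR R))) V x <= r t.
  move=> Tt tb.
  apply: (@le_trans _ _ ((- r b) - (- r t))); last first.
    have := r0 b (le_trans Tt tb); lra.
  apply: (ac_ge_integral t b V (fun x => - r x)) => //; first exact/acN/acr.
    exact: locally_integrable_fromW Tt iV b.
  have [_ _ _ h4] := sol.
  apply: (@filterS2 _ _ (ae_filter_ringOfSetsType leb) _ _ _ _ psiE h4)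
    => x H1 H2 tx _.
  have Tx : T <= x by rewrite (le_trans Tt)// ltW.
  have [d1 D1] := H1 Tx; have [d2 D2] := H2 Tx.
  have phx := phi0 x Tx; have phx0 : phi x != 0 by rewrite gt_eqF.
  have dph : is_derive (x : R) 1 phi (psi x * (p x)^-1).
    by rewrite -D1 derive1E; exact: DeriveDef.
  have dps : is_derive (x : R) 1 psi (- F x).
    have -> : - F x = derive1 psi (x : R) by lra.
    by rewrite derive1E; exact: DeriveDef.
  have dinv : is_derive (x : R) 1 (fun z => (phi z)^-1)
     (- (phi x) ^- 2 *: (psi x * (p x)^-1)).
    exact: is_deriveV.
  have dg : is_derive (x : R) 1 (- (psi * (fun z => (phi z)^-1)))
      (- (psi x *: (- (phi x) ^- 2 *: (psi x * (p x)^-1)) + (phi x)^-1 *: (- F x))).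
    by apply: is_deriveN; exact: is_deriveM.
  split; first exact: (@ex_derive _ _ _ _ _ _ _ dg).
  have := @derive_val _ _ _ _ _ _ _ dg; rewrite -derive1E => ->.
  rewrite /V /r /GRing.scale/=.
  have -> : - (psi x * (- phi x ^- 2 * (psi x / p x)) + (phi x)^-1 * - F x) =
     F x / phi x + (psi x / phi x) ^+ 2 / p x.
    have pn : p x != 0 by rewrite gt_eqF// p0.
    by field; rewrite phx0 pn.
  by rewrite lerD2r ler_pdivlMr// QF.
have [iVT _] := integral_halfline_le T (r T) V iV V0 (fun b => key T b (lexx T)).
have mT := lebesgue_measurable_itv `[T, +oo[.
have mQ f : locally_integrable_from T f ->
    (forall t, T <= t -> 0 <= f t <= V t) ->
    leb.-integrable (`[T, +oo[ : set (lebR R)) (EFin \o f).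
  move=> lf fV.
  apply: (integral_halfline_le T (r T) f lf _ _).1 => [t /fV /andP[]//|b Tb].
  apply: le_trans (key T b (lexx T) Tb).
  apply: le_Rintegral => //; first exact: lebesgue_measurable_itv.
  by move=> x /=; rewrite in_itv/= => /andP[/fV/andP[]].
split.
- by apply: mQ => // t Tt; rewrite Q0//= /V lerDl mulr_ge0 ?w0// sqr_ge0.
- apply: mQ => // t Tt.
  by rewrite mulr_ge0 ?w0 ?sqr_ge0//= /V lerDr Q0.
- move=> t Tt; apply: (integral_halfline_le t (r t) V _ _ _).2.
  + exact: locally_integrable_fromW Tt iV.
  + by move=> x tx; rewrite V0// (le_trans Tt).
  + by move=> b tb; exact: key.
Qed.

End Fixed.
End PositiveSolutions.

(** * Comparison with the ordinary differential equation *)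

Section Assembly.
Context {R : realType}.

Lemma eventually_forall_ord (n : nat) (P : 'I_n -> R -> Prop) (T0 : R) :
  (forall k, exists T, forall t, T <= t -> P k t) ->
  exists2 T, T0 <= T & forall k t, T <= t -> P k t.
Proof.
move=> H; have [f Hf] := choice H.
exists (\big[Num.max/T0]_(k < n) f k); first exact: bigmax_ge_id.
by move=> k t; move=> /(le_trans (le_bigmax _ f k)); exact: Hf.
Qed.

Lemma cvg_pinfty_eventually_ge (f : R -> R) (A : R) :
  f t @[t --> +oo] --> +oo -> exists T, forall t, T <= t -> A <= f t.
Proof.
move=> /cvgryPge /(_ A) [M [_ H]]; exists (M + 1) => t Mt; apply: H.
by rewrite (lt_le_trans _ Mt)// ltrDl.
Qed.

Lemma locally_integrable_measurable (a : R) (f : R -> R) :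
  locally_integrable_from a f ->
  measurable_fun (`[a, +oo[ : set (lebR R)) (f : lebR R -> R).
Proof.
move=> lf.
have -> : `[a, +oo[%classic = \bigcup_n (`[a, a + n%:R]%classic : set R).
  apply/seteqP; split=> x; last first.
    by case=> n _ /=; rewrite !in_itv/= andbT => /andP[].
  rewrite /= in_itv/= andbT => ax.
  exists (Num.truncn (x - a)).+1 => //; rewrite /= in_itv/= ax/=.
  by have := truncnS_gt (x - a); lra.
apply/measurable_fun_bigcup => n; first exact: lebesgue_measurable_itv.
by apply/measurable_EFinP; exact: measurable_int (lf _).
Qed.

Lemma primitive_measurable (a : R) (f : R -> R) :
  locally_integrable_from a f -> (forall t, a <= t -> 0 <= f t) ->
  measurable_fun setT (fun x : R => \int[leb]_(t in (`[a, x] : set (lebR R))) f t).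
Proof.
move=> lf f0; apply: nondecreasing_measurable => // x y xy.
have I0 (c d : R) : a <= c -> 0 <= \int[leb]_(t in (`[c, d] : set (lebR R))) f t.
  move=> ac; apply: Rintegral_ge0 => t /=; rewrite in_itv/= => /andP[ct _].
  by rewrite f0// (le_trans ac).
have [ax|xa] := leP a x.
  rewrite (Rintegral_itv_split a (BRight y) x) ?bnd_simp//.
  by rewrite lerDl I0.
by rewrite [leLHS]/Rintegral set_itv_ge ?bnd_simp -?ltNge// integral_set0 I0.
Qed.

Lemma primitive_unbounded (a T K : R) (f : R -> R) :
  locally_integrable_from a f -> (forall t, a <= t -> 0 <= f t) ->
  (\int[leb]_(t in (`[a, +oo[ : set (lebR R))) (f t)%:E = +oo)%E -> a <= T ->
  exists2 t, T <= t & K < \int[leb]_(x in (`[T, t] : set (lebR R))) f x.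
Proof.
move=> lf f0 finf aT; apply: contrapT => H.
have HK t : T <= t -> \int[leb]_(x in (`[T, t] : set (lebR R))) f x <= K.
  by move=> Tt; rewrite leNgt; apply/negP => h; apply: H; exists t.
have I0 (c d : R) : a <= c -> 0 <= \int[leb]_(t in (`[c, d] : set (lebR R))) f t.
  move=> ac; apply: Rintegral_ge0 => t /=; rewrite in_itv/= => /andP[ct _].
  by rewrite f0// (le_trans ac).
have K0 : 0 <= K by apply: le_trans (HK T (lexx T)); exact: I0.
have [] := integral_halfline_le a
  (\int[leb]_(x in (`[a, T] : set (lebR R))) f x + K) f lf f0.
  move=> b ab; have [Tb|bT] := leP T b.
    rewrite (Rintegral_itv_split a (BRight b) T) ?bnd_simp//.
    by rewrite lerD2l HK.
  rewrite (Rintegral_itv_split a (BRight T) b) ?bnd_simp//; last exact: ltW.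
  by rewrite -addrA lerDl addr_ge0 ?I0.
move=> /integrable_fin_num; rewrite finf => H1 _.
by have := H1 (lebesgue_measurable_itv _).
Qed.

End Assembly.

Section Comparison.
Context {R : realType}.

(** Two thresholds are used.  After [T1] all the values [phi (alpha_k t)] are
positive, which yields the sign of [psi] and the monotonicity of [phi]; [T1] is
also the [t1] of the comparison coefficient.  After [T2] the deviated arguments are
beyond [T1], so that this monotonicity applies to them, and those of [Omega_plus]
and [Omega_minus] lie on the corresponding side of [t].  The coefficient is written
[Q = sum_k q_k c_k] with [c_k t * phi t <= phi (alpha_k t)]. *)
Lemma no_eventually_positive_solution (n : nat) (t0 M : R) (p : R -> R)
    (q alpha : 'I_n -> R -> R) (phi psi : R -> R)
    (hq : forall k : 'I_n, locally_integrable_from t0 (q k))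
    (halpha_meas : forall k : 'I_n, lebesgue_measurable_from t0 (alpha k))
    (halpha_bnd : forall k : 'I_n, locally_bounded_from t0 (alpha k))
    (hp : forall t : R, t0 <= t -> 0 < p t)
    (hpint : locally_integrable_from t0 (fun t => (p t)^-1))
    (hq0 : forall (k : 'I_n) (t : R), t0 <= t -> 0 <= q k t)
    (halpha : forall k : 'I_n, alpha k t @[t --> +oo] --> +oo)
    (hpinf : (\int[leb]_(tau in (`[t0, +oo[%classic : set (lebR R)))
                ((p tau)^-1)%:E)%E = +oo%E)
    (hOmegaint : ((\int[leb]_(tau in (`[t0, +oo[%classic : set (lebR R)))
                (\sum_(k in Omega_plus t0 alpha) q k tau)%R%:E)%E < +oo)%E)
    (hode : forall t1 : R, t0 <= t1 ->
       ode_oscillatory (comparison_domain t0 alpha t1) p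
         (comparison_coefficient t0 p q alpha t1)) :
  t0 <= M -> (forall t, M <= t -> 0 < phi t) ->
  solution_pair t0 p phi psi (fun t => \sum_(k < n) q k t * phi (alpha k t)) ->
  False.
Proof.
move=> t0M phi0 sol0.
set F := (fun t => \sum_(k < n) _) in sol0.
set Op := Omega_plus t0 alpha in hOmegaint *.
set Om := Omega_minus t0 alpha.
have [T1 MT1 aM] := eventually_forall_ord n (fun k t => M <= alpha k t) M
  (fun k => cvg_pinfty_eventually_ge _ M (halpha k)).
have t0T1 : t0 <= T1 := le_trans t0M MT1.
have w0 t : t0 <= t -> 0 <= (p t)^-1.
  by move=> t0t; rewrite invr_ge0 ltW// hp.
(* [T'] makes [P T2 > 0], without which [1 / P] would not be monotone on [[T2, +oo[]. *)
have [T' T1T' PT'] := primitive_unbounded t0 T1 0 _ hpint w0 hpinf t0T1.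
have ev k : exists T, forall t, T <= t ->
    [/\ T1 <= alpha k t, k \in Op -> t <= alpha k t & k \in Om -> alpha k t <= t].
  have [A HA] := cvg_pinfty_eventually_ge _ T1 (halpha k).
  have [B HB] : exists B, forall t, B <= t -> k \in Op -> t <= alpha k t.
    have [|_] := boolP (k \in Op); last by exists 0.
    by rewrite inE => /asboolP[B _ HB]; exists B => t /HB.
  have [C HC] : exists C, forall t, C <= t -> k \in Om -> alpha k t <= t.
    have [|_] := boolP (k \in Om); last by exists 0.
    by rewrite inE => /asboolP[C _ HC]; exists C => t /HC.
  exists (Num.max A (Num.max B C)) => t; rewrite !ge_max => /andP[At /andP[Bt Ct]].
  by split; [exact: HA|exact: HB|exact: HC].
have [T2 T2' HT2] := eventually_forall_ord n _ (Num.max T' (T1 + 1)) ev.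
move: T2'; rewrite ge_max => /andP[T'T2 T1T2'].
have T1T2 : T1 < T2 by lra.
have t0T2 : t0 <= T2 by rewrite (le_trans t0T1)// ltW.
have p1 t : T1 <= t -> 0 < p t by move=> h; rewrite hp// (le_trans t0T1).
have ip1 := locally_integrable_fromW _ _ _ t0T1 hpint.
have pinf1 s K : T1 <= s -> exists2 t, s <= t &
    K < \int[leb]_(x in (`[s, t] : set (lebR R))) (p x)^-1.
  by move=> T1s; apply: primitive_unbounded hpint w0 hpinf _; exact: le_trans T1s.
have F1 t : T1 <= t -> 0 <= F t.
  move=> T1t; apply: sumr_ge0 => k _; rewrite mulr_ge0 ?hq0 ?(le_trans t0T1)//.
  by rewrite ltW// phi0// aM.
have phi1 t : T1 <= t -> 0 < phi t by move=> h; rewrite phi0// (le_trans MT1).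
have sol1 := solution_pairW _ _ _ _ _ _ t0T1 sol0.
have phimono := positive_solution_nondecreasing _ _ _ _ _ sol1 p1 ip1 pinf1 F1 phi1.
have ratio := positive_solution_ratio _ _ _ _ _ sol1 p1 ip1 F1 phi1.
have psi0 := quasiderivative_ge0 _ _ _ _ _ sol1 p1 ip1 pinf1 F1 phi1.
have up2 := @le_trans _ _ T2 T1 _ (ltW T1T2).
have p2 t : T2 <= t -> 0 < p t by move=> /up2/p1.
have ip2 := locally_integrable_fromW _ _ _ t0T2 hpint.
have pinf2 s K : T2 <= s -> exists2 t, s <= t &
    K < \int[leb]_(x in (`[s, t] : set (lebR R))) (p x)^-1.
  by move=> /up2; exact: pinf1.
have F2 t : T2 <= t -> 0 <= F t by move=> /up2/F1.
have phi2 t : T2 <= t -> 0 < phi t by move=> /up2/phi1.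
have sol2 := solution_pairW _ _ _ _ _ _ t0T2 sol0.
pose sq t := \sum_(j in Op) q j t.
have sq0 t : t0 <= t -> 0 <= sq t.
  by move=> t0t; apply: sumr_ge0 => j _; exact: hq0.
have isq : locally_integrable_from t0 sq.
  move=> b; have mI := lebesgue_measurable_itv `[t0, b].
  have : leb.-integrable (`[t0, b] : set (lebR R))
      (fun t => (\sum_(j in Op) (q j t)%:E)%E).
    by apply: integrable_sum => // k _; exact: hq.
  apply: eq_integrable => // t _.
  by rewrite /sq /= sumEFin.
have isqT : leb.-integrable (`[t0, +oo[ : set (lebR R)) (EFin \o sq).
  apply/integrableP; split.
    by apply/measurable_EFinP; exact: locally_integrable_measurable.
  apply: le_lt_trans hOmegaint; rewrite le_eqVlt; apply/orP; left; apply/eqP.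
  apply: eq_integral => t; rewrite inE /= in_itv/= andbT => t0t.
  by rewrite ger0_norm// sq0.
pose G tau := \int[leb]_(s in (`[tau, +oo[ : set (lebR R))) sq s.
have Gmono x y : t0 <= x -> x <= y -> G y <= G x.
  move=> t0x xy; rewrite {2}/G (Rintegral_itv_split x +oo%O y)//.
    rewrite lerDr; apply: Rintegral_ge0 => s /=; rewrite in_itv/= => /andP[xs _].
    by rewrite sq0// (le_trans t0x).
  by apply: integrable_subitv isqT; rewrite ?bnd_simp.
have G0 x : t0 <= x -> 0 <= G x.
  move=> t0x; apply: Rintegral_ge0 => s /=; rewrite in_itv/= => /andP[xs _].
  by rewrite sq0// (le_trans t0x).
pose h tau := (p tau)^-1 * G tau.
have h0 x : T2 <= x -> 0 <= h x.
  by move=> /(le_trans t0T2) t0x; rewrite mulr_ge0 ?w0 ?G0.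
have ih : locally_integrable_from T2 h.
  move=> b; have mI := lebesgue_measurable_itv `[T2, b].
  have := integrableZl mI (G T2) (ip2 b).
  apply: le_integrable; first exact: mI.
    apply/measurable_EFinP; apply: measurable_funM.
      by apply/measurable_EFinP; exact: measurable_int (ip2 b).
    have mT := lebesgue_measurable_itv `[T2, +oo[.
    apply: measurable_funS (measurable_nonincreasing_from T2 G _) => //.
      by apply: subset_itvl; rewrite bnd_simp.
    by move=> x y /(le_trans t0T2); exact: Gmono.
  move=> t /=; rewrite in_itv/= => /andP[T2t _]; rewrite lee_fin.
  have t0t := le_trans t0T2 T2t.
  rewrite !ger0_norm ?mulr_ge0 ?w0 ?G0//.
  by rewrite /h mulrC ler_wpM2r ?w0// Gmono.
have hle s : T2 <= s -> h s <= (p s)^-1 * (psi s / phi s).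
  move=> T2s; have t0s := le_trans t0T2 T2s; rewrite ler_wpM2l ?w0//.
  apply: (quasiderivative_ge_tail _ _ _ _ _ sol2 p2 ip2 pinf2 F2 phi2 sq s T2s).
  - exact: locally_integrable_fromW isq.
  - by move=> t /(le_trans t0s); exact: sq0.
  move=> t st; have T2t := le_trans T2s st; have t0t := le_trans t0s st.
  rewrite /sq mulr_suml /F.
  rewrite [leRHS](bigID (fun k => k \in Op))/= -[leLHS]addr0 lerD//.
    apply: ler_sum => k kOp; rewrite ler_wpM2l ?hq0//.
    apply: phimono; first exact: up2.
    by have [_ /(_ kOp) + _] := HT2 k t T2t; exact: le_trans.
  apply: sumr_ge0 => k _; rewrite mulr_ge0 ?hq0//.
  by rewrite ltW// phi0// aM// up2.
pose Q := comparison_coefficient t0 p q alpha T1.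
pose P x := \int[leb]_(s in (`[T1, x] : set (lebR R))) (p s)^-1.
pose H x := \int[leb]_(s in (`[T2, x] : set (lebR R))) h s.
pose c k t := if k \in Op then expR (H (alpha k t) - H t)
  else if k \in Om then P (alpha k t) * (P t)^-1 else 0.
have P0 x : 0 <= P x.
  apply: Rintegral_ge0 => s /=; rewrite in_itv/= => /andP[xs _].
  by rewrite w0// (le_trans t0T1).
have Pmono x y : T1 <= x -> x <= y -> P x <= P y.
  move=> T1x xy; rewrite {2}/P (Rintegral_itv_split T1 (BRight y) x) ?bnd_simp//.
  rewrite lerDl; apply: Rintegral_ge0 => s /=; rewrite in_itv/= => /andP[xs _].
  by rewrite w0// (le_trans t0T1)// (le_trans T1x).
have c0 k t : 0 <= c k t.
  rewrite /c; case: ifP => _; first exact: expR_ge0.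
  by case: ifP => _ //; rewrite mulr_ge0 ?invr_ge0.
have Hsub t s : T2 <= t -> t <= s ->
    \int[leb]_(x in (`[t, s] : set (lebR R))) h x = H s - H t.
  move=> T2t ts; rewrite /H (Rintegral_itv_split T2 (BRight s) t) ?bnd_simp//.
  by rewrite [in RHS]addrAC subrr add0r.
have QE t : T2 <= t -> Q t = \sum_(k < n) q k t * c k t.
  move=> T2t; rewrite /Q /comparison_coefficient -/Op -/Om.
  rewrite [RHS](bigID (fun k => k \in Op))/=; congr (_ + _).
    apply: eq_bigr => k kOp; rewrite /c kOp; congr (_ * expR _).
    have [_ /(_ kOp) ta _] := HT2 k t T2t.
    by rewrite /integral_from_to ta -Hsub.
  rewrite [RHS](bigID (fun k => k \in Om))/= [X in _ + X]big1 ?addr0; last first.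
    by move=> k /andP[/negbTE kOp /negbTE kOm]; rewrite /c kOp kOm mulr0.
  apply: eq_big => [k|k]; first by rewrite inE.
  rewrite inE => /andP[/negbTE kOp kOm]; rewrite /c kOp kOm.
  have [Ta _ _] := HT2 k t T2t.
  by rewrite /integral_from_to Ta up2.
have cphi k t : T2 <= t -> c k t * phi t <= phi (alpha k t).
  move=> T2t; have T1t := up2 t T2t; have [Ta Hp Hm] := HT2 k t T2t.
  rewrite /c; case: ifPn => [kOp|_].
    rewrite -Hsub ?Hp// mulrC.
    apply: (positive_solution_growth _ _ _ _ _ sol2 p2 ip2 pinf2 F2 phi2) => //.
    - exact: Hp.
    - exact: locally_integrable_fromW T2t ih _.
    - by move=> x tx; rewrite h0// (le_trans T2t).
    - by move=> x tx; rewrite hle// (le_trans T2t).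
  case: ifPn => [kOm|_]; last by rewrite mul0r ltW// phi1.
  have := ratio _ _ Ta (Hm kOm); rewrite -/(P _) -/(P _) => rat.
  (* for [P t = 0] the inverse is [0] and so is the left-hand side *)
  have [Pt0|Pt0] := eqVneq (P t) 0.
    by rewrite Pt0 invr0 mulr0 mul0r ltW// phi1.
  by rewrite mulrAC ler_pdivrMr ?lt0r ?Pt0 ?P0// mulrC.
have Q0 t : T2 <= t -> 0 <= Q t.
  move=> T2t; rewrite QE//; apply: sumr_ge0 => k _.
  by rewrite mulr_ge0// hq0// (le_trans t0T2).
have QF t : T2 <= t -> Q t * phi t <= F t.
  move=> T2t; rewrite QE// mulr_suml; apply: ler_sum => k _.
  by rewrite -mulrA ler_wpM2l ?cphi// hq0// (le_trans t0T2).
have mc k : measurable_fun (`[T2, +oo[ : set (lebR R)) (c k : lebR R -> R).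
  have mT := lebesgue_measurable_itv `[T2, +oo[.
  have ma : measurable_fun (`[T2, +oo[ : set (lebR R)) (alpha k : lebR R -> R).
    apply: measurable_funS (halpha_meas k); first exact: lebesgue_measurable_itv.
    by apply: subset_itvr; rewrite bnd_simp.
  have mid : measurable_fun (`[T2, +oo[ : set (lebR R)) (idfun : lebR R -> R).
    by apply: borel_lebesgue_measurable_fun; [exact: measurable_id|exact: measurable_itv].
  have [kOp|/negbTE kOp] := boolP (k \in Op).
    rewrite (_ : c k = fun t => expR (H (alpha k t) - H t)); last first.
      by apply/funext => t; rewrite /c kOp.
    have mH := primitive_measurable T2 h ih h0.
    apply: measurableT_comp; first exact: measurable_expR.
    apply: measurable_funB.
      exact: (measurableT_comp mH ma).
    exact: (measurableT_comp mH mid).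
  have [kOm|/negbTE kOm] := boolP (k \in Om); last first.
    rewrite (_ : c k = fun=> 0); first exact: measurable_cst.
    by apply/funext => t; rewrite /c kOp kOm.
  rewrite (_ : c k = fun t => P (alpha k t) * (P t)^-1); last first.
    by apply/funext => t; rewrite /c kOp kOm.
  have mP : measurable_fun setT P.
    by apply: primitive_measurable => // t /(le_trans t0T1)/w0.
  apply: measurable_funM; first exact: (measurableT_comp mP ma).
  apply: measurable_nonincreasing_from => x y T2x xy.
  have Px : 0 < P x.
    apply: lt_le_trans PT' _; apply: Pmono => //; exact: le_trans T2x.
  rewrite lef_pV2 ?posrE//; last first.
    by rewrite (lt_le_trans Px)// Pmono// up2.
  by rewrite Pmono// up2.
(* On [[T2, b]], with [A] a bound of [alpha_k], the factor [c_k] is at most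
   [phi A / phi T2], since [c_k t * phi t <= phi (alpha_k t)]. *)
have iQ : locally_integrable_from T2 Q.
  move=> b.
  have mI := lebesgue_measurable_itv `[T2, b].
  have sT2b : `[T2, b] `<=` `[T2, +oo[ by apply: subset_itvl; rewrite bnd_simp.
  have iqc k : leb.-integrable (`[T2, b] : set (lebR R))
      (fun t => (q k t * c k t)%:E).
    have [A HA] : exists A, forall t, T2 <= t -> t <= b -> alpha k t <= A.
      have [A [_ HA]] := halpha_bnd k b; exists (A + 1) => t T2t tb.
      apply: le_trans (ler_norm _) _; apply: HA; first by rewrite ltrDl.
      by rewrite /= in_itv/= tb (le_trans t0T2).
    have iq := locally_integrable_fromW _ _ _ t0T2 (hq k) b.
    have := integrableZl mI (phi (Num.max A T1) / phi T2) iq.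
    apply: le_integrable; first exact: mI.
      apply/measurable_EFinP; apply: measurable_funM.
        by apply/measurable_EFinP; exact: measurable_int iq.
      by apply: measurable_funS (mc k) => //; exact: lebesgue_measurable_itv.
    move=> t /=; rewrite in_itv/= => /andP[T2t tb]; rewrite lee_fin.
    have t0t := le_trans t0T2 T2t.
    have T1A : T1 <= Num.max A T1 by rewrite le_max lexx orbT.
    have K0 : 0 <= phi (Num.max A T1) / phi T2.
      by apply: divr_ge0; apply: ltW; [exact: phi1|exact: phi2].
    have qkt0 := hq0 k t t0t.
    rewrite (ger0_norm (mulr_ge0 qkt0 (c0 k t))) (ger0_norm (mulr_ge0 K0 qkt0)).
    rewrite mulrC ler_wpM2r// ler_pdivlMr ?phi2//.
    apply: (@le_trans _ _ (c k t * phi t)).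
      by rewrite ler_wpM2l// phimono// ltW.
    apply: le_trans (cphi k t T2t) _; apply: phimono.
      by have [] := HT2 k t T2t.
    by rewrite le_max HA.
  have : leb.-integrable (`[T2, b] : set (lebR R))
      (fun t => (\sum_(k < n) (q k t * c k t)%:E)%E).
    by apply: integrable_sum => // k _; exact: iqc.
  apply: eq_integrable => // t; rewrite inE /= in_itv/= => /andP[T2t _].
  by rewrite QE// sumEFin.
have [iQT irT rr] := riccati_inequality _ _ _ _ _ sol2 p2 ip2 pinf2 F2 phi2 Q iQ Q0 QF.
have w2 t : T2 <= t -> 0 <= (p t)^-1 by move=> T2t; rewrite w0// (le_trans t0T2).
have [u [u0 umono iu uE]] := riccati_fixed_point T2 Q (fun t => (p t)^-1)
  (fun t => psi t / phi t) Q0 w2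
  (fun t T2t => divr_ge0 (psi0 t (up2 t T2t)) (ltW (phi2 t T2t)))
  (locally_integrable_measurable _ _ ip2) iQT irT rr.
have [y [y0 acy soly]] := riccati_positive_solution T2 p Q u p2 Q0 ip2 u0 umono iu uE.
have [|t _ yt] := hode T1 t0T1 T2 y _ 0.
  split => // t /=; rewrite in_itv/= andbT => T2t; split.
    exact: lt_le_trans T2t.
  move=> k _; have [Ta _ _] := HT2 k t T2t; exact: le_trans Ta.
by have := y0 t; rewrite yt ltxx.
Qed.

End Comparison.

Lemma zero_free_sign (R : realType) (M : R) (phi : R -> R) :
  {within `[M, +oo[, continuous phi} -> (forall t, M <= t -> phi t != 0) ->
  0 < phi M -> forall t, M <= t -> 0 < phi t.
Proof.
move=> cphi nz phM t Mt; rewrite lt_neqAle eq_sym nz//= leNgt; apply/negP => neg.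
have cMt : {within `[M, t], continuous phi}.
  by apply: continuous_subspaceW cphi; apply: subset_itvl; rewrite bnd_simp.
have [|c] := IVT (v := 0) Mt cMt.
  by rewrite ge_min le_max (ltW phM) (ltW neg) orbT.
by rewrite in_itv/= => /andP[Mc _] pc; have := nz c Mc; rewrite pc eqxx.
Qed.

Lemma solution_pairN (R : realType) (T : R) (p phi psi F : R -> R) :
  solution_pair T p phi psi F ->
  solution_pair T p (fun t => - phi t) (fun t => - psi t) (fun t => - F t).
Proof.
move=> [h1 h2 h3 h4]; split.
- by move=> b; exact: acN.
- by move=> b; exact: acN.
- apply: (@filterS _ _ (ae_filter_ringOfSetsType leb)) h3 => t H Tt.
  have [d E] := H Tt; split; first exact: derivableN.
  by rewrite derive1E deriveN// -derive1E E mulrN.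
- apply: (@filterS _ _ (ae_filter_ringOfSetsType leb)) h4 => t H Tt.
  have [d E] := H Tt; split; first exact: derivableN.
  by rewrite derive1E deriveN// -derive1E; lra.
Qed.

Theorem theorem2p5 (R : realType) (n : nat) (t0 : R) (p : R -> R)
    (q alpha : 'I_n -> R -> R)
    (hn : (1 <= n)%N)
    (hq : forall k : 'I_n, locally_integrable_from t0 (q k))
    (halpha_meas : forall k : 'I_n, lebesgue_measurable_from t0 (alpha k))
    (halpha_bnd : forall k : 'I_n, locally_bounded_from t0 (alpha k))
    (hp : forall t : R, t0 <= t -> 0 < p t)
    (hpint : locally_integrable_from t0 (fun t => (p t)^-1))
    (hq0 : forall (k : 'I_n) (t : R), t0 <= t -> 0 <= q k t)
    (halpha : forall k : 'I_n, alpha k t @[t --> +oo] --> +oo)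
    (hpinf : (\int[leb]_(tau in (`[t0, +oo[%classic : set (lebR R)))
                ((p tau)^-1)%:E)%E = +oo%E)
    (hOmega : (Omega_minus t0 alpha :|: Omega_plus t0 alpha)%SET != finset.set0)
    (hOmegaint : ((\int[leb]_(tau in (`[t0, +oo[%classic : set (lebR R)))
                (\sum_(k in Omega_plus t0 alpha) q k tau)%R%:E)%E < +oo)%E)
    (hode : forall t1 : R, t0 <= t1 ->
       ode_oscillatory (comparison_domain t0 alpha t1) p
         (comparison_coefficient t0 p q alpha t1)) :
  delay_oscillatory t0 p q alpha.
Proof.
move=> phi [cphi acphi [psi [acpsi hphi hpsi]]] M0; apply: contrapT => nozero.
pose M := Num.max t0 M0.
have t0M : t0 <= M by rewrite le_max lexx.
have nz t : M <= t -> phi t != 0.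
  rewrite ge_max => /andP[_ M0t]; apply/eqP => pt0; apply: nozero.
  by exists t.
have cM : {within `[M, +oo[, continuous phi}.
  apply: continuous_subspaceW cphi; apply: subset_itvr; rewrite bnd_simp.
  by rewrite (le_trans _ t0M)// /initial_point ge_min lexx.
have sol : solution_pair t0 p phi psi
    (fun t => \sum_(k < n) q k t * phi (alpha k t)) by split.
have [pos|neg|/eqP] := ltgtP 0 (phi M); last by rewrite eq_sym (negbTE (nz M _)).
  apply: (no_eventually_positive_solution n t0 M p q alpha phi psi) => //.
  exact: zero_free_sign.
apply: (no_eventually_positive_solution n t0 M p q alpha
  (fun t => - phi t) (fun t => - psi t)) => //.
  apply: zero_free_sign.
  - by move=> x; apply: cvgN; exact: cM.
  - by move=> t Mt; rewrite oppr_eq0 nz.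
  - by rewrite oppr_gt0.
have := solution_pairN _ _ _ _ _ _ sol; congr (solution_pair _ _ _ _ _).
apply/funext => t; rewrite -sumrN; apply: eq_bigr => k _.
by rewrite mulrN.
Qed.
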